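(* Consider the 2-user MISO broadcast channel with a random time-varying jammer described in the context, with jammer-state probabilities $\lambda_{00},\lambda_{01},\lambda_{10},\lambda_{11}$ and with $\lambda_1=\lambda_{00}+\lambda_{01}>0$, $\lambda_2=\lambda_{00}+\lambda_{10}>0$. For the CSIT-JSIT configuration $\mathsf{ND}$ (no CSIT, delayed JSIT), every pair $(d_1,d_2)$ of non-negative real numbers satisfying $$\frac{d_1}{\lambda_1}+\frac{d_2}{\lambda_{00}+\lambda_{01}+\lambda_{10}}\le1,\qquad \frac{d_1}{\lambda_{00}+\lambda_{01}+\lambda_{10}}+\frac{d_2}{\lambda_2}\le1$$ belongs to the degrees-of-freedom region.
   Context: **Channel.** A transmitter with 2 antennas sends independent, uniformly distributed messages $W_1,W_2$ to two single-antenna receivers. At time $t=1,2,\dots$ receiver $k\in\{1,2\}$ observes $$Y_k(t)=\mathbf H_k(t)\mathbf X(t)+S_k(t)\,\mathbf G_k(t)\mathbf J(t)+N_k(t),$$ where $\mathbf X(t)\in\mathbb C^{2}$ is the channel input, subject to $E|\mathbf X(t)|^2\le P_T$; $\mathbf H_k(t)\in\mathbb C^{1\times 2}$ is the channel from transmitter to receiver $k$; $\mathbf G_k(t)\in\mathbb C^{1\times 2}$ is the channel from the jammer to receiver $k$; $\mathbf J(t)\in\mathbb C^2$ is the jammer's signal, of power $P_T$ (its distribution is otherwise arbitrary); $N_k(t)\sim\mathcal{CN}(0,1)$ is noise, i.i.d. over time and independent across receivers. The vectors $\mathbf H_k(t)$, $\mathbf G_k(t)$ have continuous distributions (i.e.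 with a density) with identity covariance, not depending on $P_T$, are i.i.d. over time and independent across $k$. The noise, the messages, $\mathbf H$, and the triple $(S,\mathbf J,\mathbf G)$ are mutually independent; arbitrary correlations among $S,\mathbf J,\mathbf G$ are allowed. **Jammer state.** $S(t)=(S_1(t),S_2(t))\in\{0,1\}^2$ is i.i.d. over time; $S_k(t)=1$ means receiver $k$ is jammed at time $t$ and $S_k(t)=0$ means it is not. $\lambda_{ij}=\Pr(S(t)=(i,j))$, fixed, not depending on $P_T$. $\lambda_1=\lambda_{00}+\lambda_{01}$ and $\lambda_2=\lambda_{00}+\lambda_{10}$ are the probabilities that receivers 1 and 2, respectively, are not jammed. **Information at the terminals.** Write $\mathbf H(t)=(\mathbf H_1(t),\mathbf H_2(t))$, $\mathbf H^{t}=(\mathbf H(1),\dots,\mathbf H(t))$, $S^{t}=(S(1),\dots,S(t))$. Both receivers know $\mathbf H^n$ and $S^n$ (for the whole block of length $n$). Nobody knows $\mathbf G$. The transmitter always knows the statistics of $S(t)$. In configuration $\mathsf{ND}$ the transmitter knows no channel realizations, but at time $t$ knows the past jammer states $S^{t-1}$, i.e. $\mathbf X(t)$ is a function of $(W_1,W_2,S^{t-1})$. **DoF region.** For fixed $P_T$, a rate pair $(R_1,R_2)$, $R_k=\frac1n\log|W_k|$ ($|W_k|$ the number of values of message $W_k$), is achievable if there are encoders (respecting the configuration and the power constraint) and decoders $g_k^{(n)}(Y_k^n,\mathbf H^n,S^n)$ whose error probabilities $\Pr(W_k\ne g_k^{(n)})$ tend to $0$ as $n\to\infty$ for $k=1,2$.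 The degrees-of-freedom region is the set of all $(d_1,d_2)$ with $d_k=\lim_{P_T\to\infty}\frac{R_k}{\log P_T}$ for achievable rate pairs $(R_1,R_2)=(R_1(P_T),R_2(P_T))$. *)

(* Defs.v *)
From HB Require Import structures.
From mathcomp Require Import all_boot all_order all_algebra.
From mathcomp Require Import complex.
From mathcomp Require Import all_classical all_reals all_analysis.

Set Implicit Arguments.
Unset Strict Implicit.
Unset Printing Implicit Defensive.

Import Order.TTheory GRing.Theory Num.Theory.
Import numFieldNormedType.Exports.

Local Open Scope classical_set_scope.
Local Open Scope ring_scope.

HB.instance Definition _ (R : rcfType) := isPointed.Build R[i] 0.

(* [measurableTypeR R] is R with the Borel sigma-algebra carried by
   [lebesgue_measure] and [normal_prob]. *)
Definition realpair (R : realType) (z : R[i]) :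
    measurableTypeR R * measurableTypeR R :=
  (complex.Re z, complex.Im z).

(* Borel sigma-algebra of C = R^2 *)
HB.instance Definition _ (R : realType) :=
  Measurable.copy R[i] (g_sigma_algebra_preimageType (@realpair R)).

(* matrices carry the product sigma-algebra, generated by the entries *)
Definition entry_events (d : measure_display) (T : measurableType d)
    (m n : nat) : set (set 'M[T]_(m, n)) :=
  \bigcup_(ij in [set: 'I_m * 'I_n])
    preimage_set_system setT (fun A : 'M[T]_(m, n) => A ij.1 ij.2) measurable.

HB.instance Definition _ (d : measure_display) (T : measurableType d)
    (m n : nat) :=
  Measurable.copy 'M[T]_(m, n) (g_sigma_algebraType (@entry_events d T m n)).

HB.instance Definition _ (n : nat) := isPointed.Build 'I_n.+1 ord0.

HB.instance Definition _ (n : nat) :=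
  @isMeasurable.Build default_measure_display 'I_n.+1
    discrete_measurable discrete_measurable0
    discrete_measurableC discrete_measurableU.

(* [mnormalize] divides by the total mass, here n.+1; its last argument is only
   used for a null or infinite total mass. *)
Definition uniform_ord (R : realType) (n : nat) : probability 'I_n.+1 R :=
  mnormalize (@counting 'I_n.+1 R) (dirac (ord0 : 'I_n.+1)).

Section Probability.
Context (d : measure_display) (T : measurableType d) (R : realType).
Variable P : probability T R.

Definition mutually_independent (I : eqType) (F : I -> set (set T)) : Prop :=
  forall (s : seq I) (E : I -> set T), uniq s ->
    (forall i, i \in s -> F i (E i)) ->
    P (\bigcap_(i in [set` s]) E i) = (\prod_(i <- s) P (E i))%E.

(* sigma-algebra generated by a family of random elements *)
Definition sigma_process (d' : measure_display) (T' : measurableType d')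
    (I : Type) (X : I -> T -> T') : set (set T) :=
  <<s \bigcup_(i in [set: I]) g_sigma_algebra_preimage (X i) >>.

Definition has_law (d' : measure_display) (T' : measurableType d')
    (X : T -> T') (mu : probability T' R) : Prop :=
  forall B, measurable B -> pushforward P X B = mu B.

(* independent X_i with X_i of law [mu i] *)
Definition independent_with_laws (d' : measure_display) (T' : measurableType d')
    (I : eqType) (X : I -> T -> T') (mu : I -> probability T' R) : Prop :=
  mutually_independent (fun i => g_sigma_algebra_preimage (X i)) /\
  forall i, has_law (X i) (mu i).

(* only meaningful when the real and imaginary parts are integrable *)
Definition cexpectation (Z : T -> R[i]) : R[i] :=
  (fine ('E_P[fun w => complex.Re (Z w)])
    +i* fine ('E_P[fun w => complex.Im (Z w)]))%C.

End Probability.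

Definition sqnorm (R : realType) (m n : nat) (A : 'M[R[i]]_(m, n)) : R :=
  \sum_i \sum_j (complex.Re (A i j) ^+ 2 + complex.Im (A i j) ^+ 2).

Definition realcoords (R : realType) (v : 'rV[R[i]]_2) :=
  (realpair (v 0 0), realpair (v 0 1)).

(* density with respect to Lebesgue measure on C^2 = R^4 *)
Definition has_density (R : realType) (mu : probability 'rV[R[i]]_2 R) : Prop :=
  let leb := @lebesgue_measure R in
  exists f : (measurableTypeR R * measurableTypeR R) *
             (measurableTypeR R * measurableTypeR R) -> R,
    [/\ measurable_fun setT f, forall x, 0 <= f x
      & forall A, measurable A ->
          mu (@realcoords R @^-1` A) =
          (\int[(leb \x leb) \x (leb \x leb)]_(x in A) (f x)%:E)%E].

Definition identity_covariance (R : realType)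
    (mu : probability 'rV[R[i]]_2 R) : Prop :=
  let mean i := cexpectation mu (fun v => v 0 i) in
  (\int[mu]_v (sqnorm v)%:E < +oo)%E /\
  forall i j : 'I_2,
    cexpectation mu (fun v => (v 0 i - mean i) * (v 0 j - mean j)^*) =
    (i == j)%:R.

(* CN(0, 1), as the law of (real part, imaginary part): the components are
   independent of variance 1/2; the second parameter of [normal_prob] is the
   standard deviation. *)
Definition std_cnormal (R : realType) :
    probability (measurableTypeR R * measurableTypeR R)%type R :=
  (normal_prob (0 : R) (Num.sqrt 2^-1) \x
   normal_prob (0 : R) (Num.sqrt 2^-1))%E.

(* Receivers 1 and 2 are the elements 0 and 1 of 'I_2, time starts at 0, and
   [true] is the jammed state: S(t) = (true, false) is (1, 0). *)
Record channel (R : realType) := Channel {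
  ch_display : measure_display;
  ch_space : measurableType ch_display;
  ch_prob : probability ch_space R;
  ch_H : 'I_2 -> nat -> {RV ch_prob >-> 'rV[R[i]]_2};
  ch_G : 'I_2 -> nat -> {RV ch_prob >-> 'rV[R[i]]_2};
  ch_J : nat -> {RV ch_prob >-> 'cV[R[i]]_2};
  ch_S : nat -> {RV ch_prob >-> (bool * bool)%type};
  ch_N : 'I_2 -> nat -> {RV ch_prob >-> R[i]}
}.

Definition jammed (k : 'I_2) (s : bool * bool) : bool :=
  if k == 0 then s.1 else s.2.

(* [x] is the value of the channel input X(t) *)
Definition output (R : realType) (ch : channel R) (k : 'I_2) (t : nat)
    (x : 'cV[R[i]]_2) (w : ch_space ch) : R[i] :=
  (ch_H ch k t w *m x) 0 0
  + (jammed k (ch_S ch t w))%:R * (ch_G ch k t w *m ch_J ch t w) 0 0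
  + ch_N ch k t w.

(* [muH k] and [muG k] are the laws of H_k(t) and G_k(t) *)
Record channel_assumptions (R : realType) (lambda : bool -> bool -> R)
    (muH muG : 'I_2 -> probability 'rV[R[i]]_2 R) (PT : R) (ch : channel R) :
    Prop := ChannelAssumptions {
  ch_H_iid : independent_with_laws (ch_prob ch)
    (fun kt : 'I_2 * nat => ch_H ch kt.1 kt.2) (fun kt => muH kt.1);
  ch_G_iid : independent_with_laws (ch_prob ch)
    (fun kt : 'I_2 * nat => ch_G ch kt.1 kt.2) (fun kt => muG kt.1);
  ch_N_iid : independent_with_laws (ch_prob ch)
    (fun kt : 'I_2 * nat => @realpair R \o ch_N ch kt.1 kt.2)
    (fun=> std_cnormal R);
  ch_S_indep : mutually_independent (ch_prob ch)
    (fun t : nat => g_sigma_algebra_preimage (ch_S ch t));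
  ch_S_law : forall (t : nat) (i j : bool),
    ch_prob ch (ch_S ch t @^-1` [set (i, j)]) = (lambda i j)%:E;
  ch_J_power : forall t,
    ('E_(ch_prob ch)[fun w => sqnorm (ch_J ch t w)] = PT%:E)%E;
  ch_H_N_SJG_indep : mutually_independent (ch_prob ch)
    (tnth [tuple
      sigma_process (fun kt : 'I_2 * nat => ch_H ch kt.1 kt.2 : _ -> _);
      sigma_process (fun kt : 'I_2 * nat => ch_N ch kt.1 kt.2 : _ -> _);
      sigma_process (fun t w =>
        (ch_S ch t w, ch_J ch t w, ch_G ch 0 t w, ch_G ch 1 t w))])
}.

(* A code of block length n without CSIT and with delayed JSIT; message W_k
   ranges over |W_k| = (size_k).+1 values. *)
Record block_code (R : realType) (n : nat) := BlockCode {
  size1 : nat;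
  size2 : nat;
  encoder : forall t : nat,
    'I_size1.+1 -> 'I_size2.+1 -> t.-tuple (bool * bool) -> 'cV[R[i]]_2;
  decoder1 : {mfun (n.-tuple R[i] * n.-tuple ('rV[R[i]]_2 * 'rV[R[i]]_2)
                    * n.-tuple (bool * bool))%type >-> 'I_size1.+1};
  decoder2 : {mfun (n.-tuple R[i] * n.-tuple ('rV[R[i]]_2 * 'rV[R[i]]_2)
                    * n.-tuple (bool * bool))%type >-> 'I_size2.+1}
}.

Arguments encoder {R n} _ t.

Section Transmission.
Context (R : realType) (ch : channel R) (n : nat) (c : block_code R n).

(* Sample points ((W_1, W_2), w): the messages are uniform, independent, and
   independent of the channel. *)
Definition sample : Type :=
  ('I_(size1 c).+1 * 'I_(size2 c).+1) * ch_space ch.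

Definition joint_prob :
    probability (('I_(size1 c).+1 * 'I_(size2 c).+1) * ch_space ch)%type R :=
  ((uniform_ord R (size1 c) \x uniform_ord R (size2 c))%E \x ch_prob ch)%E.

Definition W1 (z : sample) := z.1.1.
Definition W2 (z : sample) := z.1.2.

(* X(t) sees the jammer states at times 0, ..., t-1 only *)
Definition input (t : nat) (z : sample) : 'cV[R[i]]_2 :=
  encoder c t (W1 z) (W2 z) [tuple ch_S ch i z.2 | i < t].

Definition observation (k : 'I_2) (z : sample) :=
  ([tuple output k i (input i z) z.2 | i < n],
   [tuple (ch_H ch 0 i z.2, ch_H ch 1 i z.2) | i < n],
   [tuple ch_S ch i z.2 | i < n]).

Definition error1 : \bar R :=
  joint_prob [set z | decoder1 c (observation 0 z) <> W1 z].
Definition error2 : \bar R :=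
  joint_prob [set z | decoder2 c (observation 1 z) <> W2 z].

Definition power_constraint (PT : R) : Prop :=
  forall t, (t < n)%N -> ('E_joint_prob[fun z => sqnorm (input t z)] <= PT%:E)%E.

End Transmission.

(* As |W_k| is an integer, R_k is the limit of (1/n) log |W_k|. *)
Definition achievable_ND (R : realType) (PT : R) (ch : channel R) (R1 R2 : R) :
    Prop :=
  exists c : forall n, block_code R n,
    [/\ forall n, power_constraint ch (c n) PT,
        ln (size1 (c n)).+1%:R / n%:R @[n --> \oo] --> R1,
        ln (size2 (c n)).+1%:R / n%:R @[n --> \oo] --> R2,
        error1 ch (c n) @[n --> \oo] --> 0%E
      & error2 ch (c n) @[n --> \oo] --> 0%E].

(* [ch PT] is the channel at power PT *)
Definition dof_region_ND (R : realType) (ch : R -> channel R) : set (R * R) :=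
  [set d | exists R1 R2 : R -> R,
    [/\ forall PT, 0 < PT -> achievable_ND PT (ch PT) (R1 PT) (R2 PT),
        R1 PT / ln PT @[PT --> +oo] --> d.1
      & R2 PT / ln PT @[PT --> +oo] --> d.2]].

(* Main.v *)
(* With no CSIT the channel behaves, in terms of degrees of freedom, like a
   two-user erasure broadcast channel with state feedback, one QAM symbol (over
   an alphabet of [q ~ PT] points) per unjammed slot.  A fraction of the time is
   spent on coded symbols for receiver 1, then for receiver 2; a symbol jammed
   at its addressee but heard by the other receiver is useful to both of them
   when it is added to such a symbol of the other stream, so the third phase
   sends linear combinations of these symbols.

   Everything is made deterministic by the crude estimate that there are at
   most [2 ^ n * q ^ D] words of weight at most [D]: since [q] tends to infinity
   with [PT], the factor [2 ^ n] costs no degree of freedom, and linear codes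
   found by counting work simultaneously for all jammer patterns and all
   symbol-error patterns of small weight.  Decoding thus fails only if the
   jammer states are atypical or if too many slots have a small gain or a large
   noise; Chebyshev's inequality bounds each of these events separately, so the
   joint dependence of gain, noise and jammer state plays no role. *)
Require Import Defs.
From HB Require Import structures.
From mathcomp Require Import all_boot all_order all_algebra finfield.
From mathcomp Require Import complex ring lra zify.
From mathcomp Require Import all_classical all_reals all_analysis.
From mathcomp Require Import measurable_realfun.

Set Implicit Arguments.
Unset Strict Implicit.
Unset Printing Implicit Defensive.

Import Order.TTheory GRing.Theory Num.Theory.
Import numFieldNormedType.Exports.

Local Open Scope ring_scope.

(** * Linear codes over a large alphabet *)

(** Put [L = lambda00 + lambda01 + lambda10]. A coded symbol is lost for good only when both
    receivers are jammed. Hence outer codes [G1], [G2] of rate about [L] suffice, and the first two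
    phases take fractions [d1 / L] and [d2 / L] of the time. Receiver 1 misses a fraction [lambda10]
    of its phase and has to recover these symbols from the unjammed slots of the third phase:
    [lambda10 * d1 / L <= l1 * (1 - d1 / L - d2 / L)]. This is the first bound, rearranged; the
    second one is its mirror image. On the boundary of the region there is no slack, so both phases
    are shrunk by a factor [1 - C * e] to absorb fluctuations of order [e * n].

    Undetected symbol errors in the first two phases would spoil the cancellation of overheard
    symbols in the third. Therefore the decoder does not work in stages: it looks for a message
    consistent with the whole block up to few mismatches, and [Theta] is chosen so that the weight
    of its input and the weight of its output are controlled together. Only a receiver's own message
    is claimed to be unique; the other one is merely quantified over. *)

Section HammingWeight.
Variable F : finFieldType.
Local Notation q := #|F|.

Definition hwt n (v : 'rV[F]_n) : nat := #|[pred i | v 0 i != 0]|.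

Lemma hwt_row_mx m n (u : 'rV[F]_m) (v : 'rV[F]_n) :
  hwt (row_mx u v) = (hwt u + hwt v)%N.
Proof.
rewrite /hwt -!sum1_card big_split_ord /=.
by congr addn; apply: eq_bigl => i; rewrite !inE ?row_mxEl ?row_mxEr.
Qed.

(** A word of small weight is determined by its support and by its values there, listed in order and
    padded to length [D]. *)
Lemma card_hwt_le n D :
  (#|[set v : 'rV[F]_n | hwt v <= D]| <= 2 ^ n * q ^ D)%N.
Proof.
pose f (p : {set 'I_n} * D.-tuple F) : 'rV[F]_n :=
  \row_i (if i \in p.1 then p.2`_(index i (enum p.1)) else 0).
have -> : (2 ^ n * q ^ D = #|{: {set 'I_n} * D.-tuple F}|)%N.
  rewrite card_prod card_tuple; congr muln.
  by rewrite -cardsT -powersetT card_powerset cardsT card_ord.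
rewrite -cardsT; apply: leq_trans (leq_imset_card f _).
apply/fintype.subset_leq_card/fintype.subsetP => v; rewrite inE => vD.
pose A := [set i | v 0 i != 0].
have AD : (#|A| <= D)%N by rewrite cardsE.
apply/finset.imsetP; exists (A, [tuple [seq v 0 i | i <- enum A]`_d | d < D]) => //.
apply/rowP => i; rewrite mxE [_.1]/= [_.2]/=.
case: ifPn => [iA|]; last by rewrite inE negbK => /eqP.
have iE : (index i (enum A) < size (enum A))%N by rewrite index_mem mem_enum.
have iD : (index i (enum A) < D)%N by apply: leq_trans AD; rewrite cardE.
rewrite -[X in _`_X]/(nat_of_ord (Ordinal iD)) -tnth_nth tnth_mktuple.
by rewrite (nth_map i) // nth_index // mem_enum.
Qed.

(* Random linear coding: each pair [(y, c)] with [y != 0] is hit by a fraction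
   [q ^ - n] of all matrices. *)
Lemma avoiding_matrix k n (C : {set 'rV[F]_k * 'rV[F]_n}) :
  (forall p, p \in C -> p.1 != 0) -> (#|C| < q ^ n)%N ->
  exists G : 'M[F]_(k, n), forall p, p \in C -> p.1 *m G != p.2.
Proof.
move=> C0 ltC; pose bad (p : 'rV[F]_k * 'rV[F]_n) := [set G : 'M[F]_(k, n) | p.1 *m G == p.2].
have bad_card p : p \in C -> (#|bad p| * q ^ n <= #|{: 'M[F]_(k, n)}|)%N.
  move=> /C0; case: p => y c /= /eqP/rowP y0.
  have [i yi] : exists i, y 0 i != 0.
    apply/existsP; apply: contraT => /existsPn yN; exfalso; apply: y0 => i.
    by rewrite mxE; move: (yN i); rewrite negbK => /eqP.
  have -> : (q ^ n = #|[set: 'rV[F]_n]|)%N by rewrite cardsT card_mx mul1n.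
  rewrite -cardsX -cardsT.
  (* Adding [r] to row [i] of a bad [G] changes [y *m G] by [y 0 i] times [r]. As [y 0 i] is
     invertible, [r] and then [G] can be read off from the sum. *)
  have injf : {in finset.setX (bad (y, c)) [set: 'rV[F]_n] &,
      injective (fun p : 'M[F]_(k, n) * 'rV[F]_n => p.1 + delta_mx i 0 *m p.2)}.
    move=> [G r] [G' r']; rewrite !inE /= !andbT => /eqP Gc /eqP Gc' E.
    have : y *m (G + delta_mx i 0 *m r) = y *m (G' + delta_mx i 0 *m r').
      by rewrite E.
    rewrite !mulmxDr Gc Gc' => /addrI; rewrite !mulmxA.
    have -> : y *m delta_mx i 0 = (y 0 i)%:M :> 'M[F]_1.
      by rewrite -colE; apply/matrixP => a b; rewrite !ord1 !mxE eqxx mulr1n.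
    rewrite !mul_scalar_mx => /scalerI -/(_ yi) rr'.
    by move: E; rewrite rr' => /addIr ->.
  by rewrite -(card_in_imset injf); apply/fintype.subset_leq_card/finset.subsetT.
case: (boolP [exists G : 'M[F]_(k, n), [forall p in C, p.1 *m G != p.2]]).
  by move=> /existsP[G /forall_inP]; exists G.
move=> /existsPn allbad.
have cover : [set: 'M[F]_(k, n)] \subset \big[@finset.setU _/finset.set0]_(p in C) bad p.
  apply/fintype.subsetP => G _; have /forall_inPn[p pC] := allbad G.
  by rewrite negbK => bp; apply/finset.bigcupP; exists p; rewrite // inE.
have card_le : (#|{: 'M[F]_(k, n)}| <= \sum_(p in C) #|bad p|)%N.
  rewrite -cardsT; apply: leq_trans (fintype.subset_leq_card cover) _.
  elim/big_rec2: _ => [|p a A _ le]; first by rewrite cards0.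
  by apply: leq_trans (leq_card_setU _ _) _; rewrite leq_add2l.
have M0 : (0 < #|{: 'M[F]_(k, n)}|)%N by apply/card_gt0P; exists 0.
suff : (q ^ n * #|{: 'M[F]_(k, n)}| <= #|C| * #|{: 'M[F]_(k, n)}|)%N.
  by rewrite leq_pmul2r // leqNgt ltC.
rewrite mulnC; apply: leq_trans (leq_mul card_le (leqnn _)) _.
by rewrite big_distrl /= -sum_nat_const; apply: leq_sum => p /bad_card.
Qed.

(** The pairs to avoid are a nonzero message with a word of weight at most [D]. *)
Lemma gilbert_varshamov k n D : (q ^ k * (2 ^ n * q ^ D) < q ^ n)%N ->
  exists G : 'M[F]_(k, n), forall y, y != 0 -> (D < hwt (y *m G))%N.
Proof.
move=> lt; pose C := finset.setX [set y : 'rV[F]_k | y != 0]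
                          [set c : 'rV[F]_n | (hwt c <= D)%N].
have [||G HG] := @avoiding_matrix k n C.
- by move=> [y c]; rewrite !inE => /andP[].
- apply: leq_ltn_trans lt; rewrite cardsX leq_mul ?card_hwt_le //.
  by rewrite -[X in (X ^ k)%N]/(q) -[k in X in (_ <= X)%N]mul1n -card_mx max_card.
exists G => y y0; rewrite ltnNge; apply/negP => le.
by have := HG (y, y *m G); rewrite !inE y0 le /= eqxx => /(_ isT).
Qed.

(** Input and output are counted together as one word of length [k + n]. The input therefore costs a
    factor [2 ^ k] instead of [q ^ k], and a redundancy [n] slightly above [D] is enough. *)
Lemma gilbert_varshamov_systematic k n D :
  (2 ^ (k + n) * q ^ D < q ^ n)%N ->
  exists G : 'M[F]_(k, n), forall y, y != 0 -> (D < hwt y + hwt (y *m G))%N.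
Proof.
move=> lt; pose C := [set p : 'rV[F]_k * 'rV[F]_n |
                        (p.1 != 0) && (hwt p.1 + hwt p.2 <= D)%N].
have [||G HG] := @avoiding_matrix k n C.
- by move=> [y c]; rewrite !inE => /andP[].
- apply: leq_ltn_trans lt; apply: leq_trans (card_hwt_le _ _).
  rewrite -(@card_in_imset _ _ (fun p => row_mx p.1 p.2) (mem C)).
    apply/fintype.subset_leq_card/fintype.subsetP => _ /imsetP[p pC ->].
    by move: pC; rewrite !inE hwt_row_mx => /andP[].
  by move=> [a b] [a' b'] _ _ /= /eq_row_mx[-> ->].
exists G => y y0; rewrite ltnNge; apply/negP => le.
by have := HG (y, y *m G); rewrite !inE y0 le /= eqxx => /(_ isT).
Qed.

(* [w] is the difference of two uncoded streams, [mask] the retransmitted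
   positions, [own] the positions of the receiver's own stream, [jam] and
   [jam'] the positions this receiver cannot observe. *)
Lemma masked_uniqueness N K D (G : 'M[F]_(N, K)) (w : 'rV[F]_N)
    (own mask jam : pred 'I_N) (jam' : pred 'I_K) (d : nat) :
  (forall y, y != 0 -> (D < hwt y + hwt (y *m G))%N) ->
  (forall i, mask i -> ~~ own i -> ~~ jam i) ->
  let z := \row_i (if mask i then w 0 i else 0) in
  (#|[pred i | ~~ jam i & (w 0 i != 0)%R]|
   + #|[pred i | ~~ jam' i & ((z *m G) 0 i != 0)%R]| <= d)%N ->
  (#|[pred i | [&& own i, mask i & jam i]]| + #|jam'| + d <= D)%N ->
  (#|[pred i | own i && (w 0 i != 0)%R]|
     <= #|[pred i | [&& own i, jam i & ~~ mask i]]| + d)%N.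
Proof.
move=> HG mask_own z le_d le_D.
have hz : (hwt z <= #|[pred i | [&& own i, mask i & jam i]]|
                    + #|[pred i | ~~ jam i & (w 0 i != 0)%R]|)%N.
  rewrite -cardUI; apply: leq_trans (leq_addr _ _).
  apply/fintype.subset_leq_card/fintype.subsetP => i; rewrite !inE mxE.
  case: (boolP (mask i)) => // mi wi; last by rewrite eqxx in wi.
  rewrite wi andbT /=; case: (boolP (jam i)) => ji; rewrite ?orbT // !andbT.
  (* A repeated symbol of the other stream is observed here, so if it is nonzero it is already
     counted among the [d] visible differences. *)
  by have := mask_own _ mi; rewrite ji orbF; case: (own i) => // /(_ isT).
have hzG : (hwt (z *m G) <= #|jam'| + #|[pred i | ~~ jam' i & ((z *m G) 0 i != 0)%R]|)%N.
  rewrite -cardUI; apply: leq_trans (leq_addr _ _).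
  apply/fintype.subset_leq_card/fintype.subsetP => i; rewrite !inE => ->.
  by rewrite andbT /in_mem /=; case: (jam' i).
(* The weights of [z] and of [z *m G] add up to at most the unobserved positions plus [d], hence to
   at most [D]. *)
have z0 : z = 0.
  by apply/eqP; apply: contraT => /HG; lia.
apply: (@leq_trans (#|[pred i | [&& own i, jam i & ~~ mask i]]|
                    + #|[pred i | ~~ jam i & (w 0 i != 0)%R]|)); last lia.
rewrite -cardUI; apply: leq_trans (leq_addr _ _).
apply/fintype.subset_leq_card/fintype.subsetP => i; rewrite !inE => /andP[oi wi].
rewrite oi wi andbT /=; case: (boolP (jam i)) => //= _; rewrite ?orbT //.
rewrite orbF; apply: contraNN wi => mi.
by have := congr1 (fun v : 'rV_N => v 0 i) z0; rewrite !mxE mi => ->.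
Qed.

End HammingWeight.

Local Open Scope classical_set_scope.
Local Open Scope ring_scope.

(** * Measurability and probability *)

Section FiniteValued.
Context d (Z : measurableType d).

(* A map into a finite type is handled through its fibers, without a
   sigma-algebra on the target. *)
Definition measurable_fibers (I : Type) (f : Z -> I) : Prop :=
  forall i, measurable (f @^-1` [set i]).

Lemma measurable_fibers_preimage (I : finType) (f : Z -> I) (B : set I) :
  measurable_fibers f -> measurable (f @^-1` B).
Proof.
move=> mf; have -> : f @^-1` B = \bigcup_(i in B) (f @^-1` [set i]).
  by apply/seteqP; split=> [z Bz|z [i Bi /= fz]]; [exists (f z)|rewrite /= fz].
by apply: fin_bigcup_measurable => // i _; exact: mf.
Qed.

Lemma measurable_fibers_measurable_fun (I : finType) d' (Y : measurableType d')
    (f : Z -> I) (g : I -> Y) :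
  measurable_fibers f -> measurable_fun setT (g \o f).
Proof.
by move=> mf _ B _; rewrite setTI comp_preimage; apply: measurable_fibers_preimage.
Qed.

Lemma measurable_fibers_pair (I J : Type) (f : Z -> I) (g : Z -> J) :
  measurable_fibers f -> measurable_fibers g ->
  measurable_fibers (fun z => (f z, g z)).
Proof.
move=> mf mg [i j].
have -> : (fun z => (f z, g z)) @^-1` [set (i, j)]
    = f @^-1` [set i] `&` g @^-1` [set j].
  by apply/seteqP; split=> z /= [-> ->].
exact: measurableI.
Qed.

Lemma measurable_fibers_bool (b : Z -> bool) :
  measurable [set z | b z] -> measurable_fibers b.
Proof.
move=> mb [].
  by rewrite (_ : b @^-1` [set true] = [set z | b z])//; apply/seteqP; split.
rewrite (_ : b @^-1` [set false] = ~` [set z | b z]); first exact: measurableC.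
by apply/seteqP; split=> z /=; [move=> ->|move/negP/negbTE].
Qed.

Lemma measurable_fibers_ffun (K : finType) (J : Type) (f : K -> Z -> J) :
  (forall k, measurable_fibers (f k)) ->
  measurable_fibers (fun z => [ffun k => f k z]).
Proof.
move=> mf v.
have -> : (fun z => [ffun k => f k z]) @^-1` [set v]
    = \bigcap_(k in [set: K]) (f k @^-1` [set v k]).
  apply/seteqP; split=> [z /= <- k _ /=|z h]; first by rewrite ffunE.
  by apply/ffunP => k; rewrite ffunE; apply: h.
by apply: fin_bigcap_measurable => // k _; exact: mf.
Qed.

Lemma measurable_fibers_tuple n (J : Type) (f : 'I_n -> Z -> J) :
  (forall k, measurable_fibers (f k)) ->
  measurable_fibers (fun z => [tuple f k z | k < n]).
Proof.
move=> mf v.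
have -> : (fun z => [tuple f k z | k < n]) @^-1` [set v]
    = \bigcap_(k in [set: 'I_n]) (f k @^-1` [set tnth v k]).
  apply/seteqP; split=> [z /= <- k _ /=|z h]; first by rewrite tnth_mktuple.
  by apply: eq_from_tnth => k; rewrite tnth_mktuple; apply: h.
by apply: fin_bigcap_measurable => // k _; exact: mf.
Qed.

Lemma measurable_fun_fibers_ord n (f : Z -> 'I_n.+1) :
  measurable_fun setT f -> measurable_fibers f.
Proof. by move=> mf i; rewrite -[X in measurable X]setTI; exact: mf. Qed.

Lemma measurable_fun_fibers_bool2 (f : Z -> bool * bool) :
  measurable_fun setT f -> measurable_fibers f.
Proof.
move=> mf [i j]; rewrite -[X in measurable X]setTI; apply: mf => //.
have -> : [set (i, j)] = [set i] `*` [set j].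
  by apply/seteqP; split=> [[a b] [-> ->]|[a b] /= [-> ->]].
exact: measurableX.
Qed.

End FiniteValued.

Section ComplexMeasurability.
Context {R : realType} d (Z : measurableType d).
Implicit Types f g : Z -> R[i].

Lemma measurable_realpair : measurable_fun setT (@realpair R).
Proof. by move=> _ B mB; rewrite setTI; exists B => //; rewrite setTI. Qed.

Lemma measurable_complexP f : measurable_fun setT f <->
  measurable_fun setT (fun z => complex.Re (f z) : measurableTypeR R) /\
  measurable_fun setT (fun z => complex.Im (f z) : measurableTypeR R).
Proof.
split=> [mf|[mRe mIm]].
  have h := measurableT_comp measurable_realpair mf.
  split.
    exact: (measurableT_comp measurable_fst h).
  exact: (measurableT_comp measurable_snd h).
move=> _ _ [B mB <-]; rewrite !setTI -comp_preimage -[X in measurable X]setTI.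
by have := @measurable_fun_pair _ _ _ _ _ _ _ _ mRe mIm; apply.
Qed.

Lemma measurable_complexD f g : measurable_fun setT f -> measurable_fun setT g ->
  measurable_fun setT (fun z => f z + g z).
Proof.
move=> /measurable_complexP[f1 f2] /measurable_complexP[g1 g2].
apply/measurable_complexP; split.
  by apply: (eq_measurable_fun _ _ (measurable_funD f1 g1)) => z _ /=; case: (f z) (g z) => [? ?] [].
by apply: (eq_measurable_fun _ _ (measurable_funD f2 g2)) => z _ /=; case: (f z) (g z) => [? ?] [].
Qed.

Lemma measurable_complexN f : measurable_fun setT f ->
  measurable_fun setT (fun z => - f z).
Proof.
move=> /measurable_complexP[f1 f2]; apply/measurable_complexP; split.
  by apply: (eq_measurable_fun _ _ (measurable_funN f1)) => z _ /=; case: (f z).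
by apply: (eq_measurable_fun _ _ (measurable_funN f2)) => z _ /=; case: (f z).
Qed.

Lemma measurable_complexM f g : measurable_fun setT f -> measurable_fun setT g ->
  measurable_fun setT (fun z => f z * g z).
Proof.
move=> /measurable_complexP[f1 f2] /measurable_complexP[g1 g2].
apply/measurable_complexP; split.
  apply: (eq_measurable_fun _ _ (measurable_funB (measurable_funM f1 g1) (measurable_funM f2 g2))) => z _ /=.
  by case: (f z) (g z) => [? ?] [].
apply: (eq_measurable_fun _ _ (measurable_funD (measurable_funM f1 g2) (measurable_funM f2 g1))) => z _ /=.
by case: (f z) (g z) => [? ?] [].
Qed.

Definition sqmod (z : R[i]) : R := complex.Re z ^+ 2 + complex.Im z ^+ 2.

Lemma measurable_sqmod f : measurable_fun setT f ->
  measurable_fun setT (fun z => sqmod (f z)).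
Proof.
move=> /measurable_complexP[f1 f2].
by apply: measurable_funD; apply: measurable_funX.
Qed.

Lemma measurable_sqmod_le f (y : R) : measurable_fun setT f ->
  measurable [set z | sqmod (f z) <= y].
Proof.
move=> mf; rewrite -[X in measurable X]setTI.
have := measurable_fun_ler (measurable_sqmod mf) (@measurable_cst _ _ _ _ setT y).
by move=> /(_ measurableT [set true]); apply.
Qed.

Lemma measurable_sqmod_ge f (y : R) : measurable_fun setT f ->
  measurable [set z | y <= sqmod (f z)].
Proof.
move=> mf; rewrite -[X in measurable X]setTI.
have := measurable_fun_ler (@measurable_cst _ _ _ _ setT y) (measurable_sqmod mf).
by move=> /(_ measurableT [set true]); apply.
Qed.

Lemma measurable_mx_entry d' (T : measurableType d') m n i j :
  measurable_fun setT (fun A : 'M[T]_(m, n) => A i j).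
Proof.
move=> _ B mB; rewrite setTI; apply: sub_sigma_algebra.
by exists (i, j) => //; exists B => //; rewrite setTI.
Qed.

End ComplexMeasurability.

Lemma measurable_sqr_sum_ge (R : realType) (y : R) :
  measurable [set z : measurableTypeR R * measurableTypeR R |
              y <= (z.1 : R) ^+ 2 + (z.2 : R) ^+ 2].
Proof.
rewrite -[X in measurable X]setTI.
have ms : measurable_fun setT (fun z : measurableTypeR R * measurableTypeR R =>
    (z.1 : R) ^+ 2 + (z.2 : R) ^+ 2).
  by apply: measurable_funD; apply: measurable_funX.
have := measurable_fun_ler (@measurable_cst _ _ _ _ setT y) ms.
by move=> /(_ measurableT [set true]); apply.
Qed.

(** * Continuity from above and Chebyshev's inequality *)

Section Probability.
Context d (T : measurableType d) (R : realType) (P : probability T R).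

Lemma small_probability (F : (set T)^nat) : (forall i, measurable (F i)) ->
  nonincreasing_seq F -> P (\bigcap_n F n) = 0%E ->
  forall e : R, 0 < e -> exists n, (P (F n) <= e%:E)%E.
Proof.
move=> mF niF F0 e e0.
have := nonincreasing_cvg_mu (le_lt_trans (probability_le1 P (mF 0%N)) (ltry 1))
  mF (bigcap_measurable (ex_intro _ 0%N I) (fun i _ => mF i)) niF.
rewrite [X in _ --> X](_ : _ = 0%E) // => /fine_cvgP[[a _ Ha]].
move=> /cvgrPdist_le/(_ e e0)[b _ Hb].
exists (maxn a b); have /= := Hb (maxn a b) (leq_maxr _ _).
rewrite sub0r normrN => le.
have /esym PF := fineK (Ha (maxn a b) (leq_maxl _ _)).
have : ((fine ((P \o F) (maxn a b)))%:E <= e%:E)%E.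
  by rewrite lee_fin; exact: le_trans (ler_norm _) le.
by move: PF => /= <-.
Qed.

Lemma expectation_bool (b : T -> bool) : measurable [set x | b x] ->
  ('E_P[fun x => (b x)%:R] = P [set x | b x])%E.
Proof.
move=> mb; rewrite -expectation_indic //; congr expectation; apply/funext => x.
by rewrite indicE; congr (_%:R); congr nat_of_bool; apply/idP/idP; rewrite inE.
Qed.

(** Chebyshev's inequality for pairwise independent events. The deviation is measured against [n]
    rather than [#|I|], so that short or even empty phases obey the same bound as the whole
    block. *)
Lemma count_upper_tail (I : finType) (b : I -> T -> bool) (p e : R) (n : nat) :
  (forall i, measurable [set x | b i x]) ->
  (forall i, P [set x | b i x] = p%:E) ->
  (forall i j, i != j -> P ([set x | b i x] `&` [set x | b j x]) = (p * p)%:E) ->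
  (#|I| <= n)%N -> (0 < n)%N -> 0 < e ->
  (P [set x | (p * #|I|%:R + e * n%:R <= #|[pred i | b i x]|%:R)%R]
     <= ((e ^+ 2 * n%:R)^-1)%:E)%E.
Proof.
move=> mb Pb Pbb In n0 e0.
pose X x : R := \sum_i (b i x)%:R.
have XE x : X x = #|[pred i | b i x]|%:R.
  rewrite -sum1_card natr_sum [RHS]big_mkcond.
  by apply: eq_bigr => i _; rewrite inE; case: (b i x).
pose m : R := p * #|I|%:R.
(* An empty index set leaves [p] unconstrained, but then the mean [m] vanishes. *)
have p01 : 0 <= p <= 1 \/ (#|I| = 0)%N.
  case: (pickP I) => [i _|I0]; [left|right; exact: eq_card0].
  by rewrite -!lee_fin -(Pb i) probability_le1 // measure_ge0.
have mbR i : measurable_fun setT (fun x => (b i x)%:R : R).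
  have := @measurable_fibers_measurable_fun _ T bool _ R (b i) (fun c => c%:R).
  by apply; exact: measurable_fibers_bool.
have mX : measurable_fun setT X by apply: measurable_sum.
pose Y x : R := (X x - m) ^+ 2.
have mY : measurable_fun setT Y by apply: measurable_funX; apply: measurable_funB.
have en0 : 0 < e * n%:R by rewrite mulr_gt0 // ltr0n.
have m0 : 0 <= m by case: p01 => [/andP[p0 _]|I0]; rewrite /m; [rewrite mulr_ge0|rewrite I0 mulr0].
have X0 x : 0 <= X x by rewrite /X sumr_ge0.
have mbb i j : measurable [set x | b i x && b j x].
  rewrite (_ : [set x | _] = [set x | b i x] `&` [set x | b j x]).
    exact: measurableI.
  by apply/seteqP; split=> x /= => [/andP[-> ->]|[-> ->]].
have intb (c : T -> bool) : measurable [set x | c x] ->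
    (\int[P]_x ((c x)%:R : R)%:E = P [set x | c x])%E.
  by move=> mc; rewrite -expectation_bool // unlock.
have EX : (\int[P]_x (X x)%:E = m%:E)%E.
  under eq_integral do rewrite /X -sumEFin.
  rewrite ge0_integral_sum //; last by move=> i; apply/measurable_EFinP.
  under eq_bigr do rewrite intb // Pb.
  by rewrite sumEFin sumr_const /m mulr_natr.
pose V : R := m * (1 - p) + m ^+ 2.
have EXX : (\int[P]_x (X x ^+ 2)%:E = V%:E)%E.
  have XX x : X x ^+ 2 = \sum_i \sum_j (b i x && b j x)%:R.
    rewrite expr2 /X mulr_suml; apply: eq_bigr => i _; rewrite mulr_sumr.
    by apply: eq_bigr => j _; rewrite -natrM mulnb.
  under eq_integral do rewrite XX -sumEFin.
  have mbbR i j : measurable_fun setT (fun x => (b i x && b j x)%:R : R).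
    have := @measurable_fibers_measurable_fun _ T bool _ R
      (fun x => b i x && b j x) (fun c => c%:R).
    by apply; exact: measurable_fibers_bool.
  rewrite ge0_integral_sum //; last 2 first.
  - move=> i; apply/measurable_EFinP; apply: measurable_sum => j.
    exact: mbbR.
  - by move=> i x _; rewrite lee_fin sumr_ge0.
  have row i : (\int[P]_x (\sum_j (b i x && b j x)%:R : R)%:E
                = (p + (p * p) *+ #|I|.-1)%:E)%E.
    under eq_integral do rewrite -sumEFin.
    rewrite ge0_integral_sum //; last by move=> j; exact/measurable_EFinP.
    under eq_bigr => j _ do rewrite intb //.
    rewrite (bigD1 i) //= (_ : [set x | b i x && b i x] = [set x | b i x]).
      rewrite Pb (eq_bigr (fun=> (p * p)%:E)); last first.
        move=> j ji; rewrite -(Pbb i j) 1?eq_sym //; congr (P _).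
        by apply/seteqP; split=> x /= => [/andP[-> ->]|[-> ->]].
      by rewrite sumEFin sumr_const (eq_card (B := predC1 i)) // cardC1.
    by apply/seteqP; split=> x /=; rewrite andbb.
  under eq_bigr do rewrite row.
  rewrite sumEFin sumr_const /V /m; congr EFin.
  move: #|I| => [|k] /=; first by rewrite mulr0n; ring.
  by ring.
have EY : (\int[P]_x (Y x)%:E <= n%:R%:E)%E.
  (* The variance comes from the identity [Y + 2 * m * X = X ^+ 2 + m ^+ 2], whose terms are all
     nonnegative, so integrals can be added without an integrability argument. *)
  have E1 : (\int[P]_x ((Y x)%:E + (2 * m * X x)%:E)
             = \int[P]_x (Y x)%:E + (2 * m * m)%:E)%E.
    rewrite ge0_integralD //; last 4 first.
    - by move=> x _; rewrite lee_fin sqr_ge0.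
    - exact/measurable_EFinP.
    - by move=> x _; rewrite lee_fin mulr_ge0 // mulr_ge0.
    - by apply/measurable_EFinP; apply: measurable_funM.
    under [X in (_ + X)%E]eq_integral do rewrite EFinM.
    rewrite ge0_integralZl ?EX //.
    - exact/measurable_EFinP.
    - by move=> x _; rewrite lee_fin.
    - by rewrite lee_fin mulr_ge0.
  have E2 : (\int[P]_x ((X x ^+ 2)%:E + (m ^+ 2)%:E) = (V + m ^+ 2)%:E)%E.
    rewrite ge0_integralD //; last 3 first.
    - by move=> x _; rewrite lee_fin sqr_ge0.
    - by apply/measurable_EFinP; apply: measurable_funX.
    - by move=> x _; rewrite lee_fin sqr_ge0.
    by rewrite EXX integral_cst // [X in (_ + _ * X)%E](probability_setT P) mule1.
  have : (\int[P]_x (Y x)%:E + (2 * m * m)%:E = (V + m ^+ 2)%:E)%E.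
    rewrite -E1 -E2; apply: eq_integral => x _; rewrite -!EFinD; congr EFin.
    by rewrite /Y; ring.
  move=> /(congr1 (fun u => u - (2 * m * m)%:E)%E).
  rewrite addeK // -EFinB => ->; rewrite lee_fin.
  have -> : V + m ^+ 2 - 2 * m * m = m * (1 - p) by rewrite /V; ring.
  apply: (@le_trans _ _ #|I|%:R); last by rewrite ler_nat.
  rewrite /m; case: p01 => [/andP[p0 p1]|->]; last by rewrite mulr0 mul0r.
  have I0 : 0 <= #|I|%:R :> R by [].
  by nra.
have en2 : 0 < (e * n%:R) ^+ 2 by rewrite exprn_gt0.
set A := [set x | _].
have mA : measurable A.
  rewrite (_ : A = [set x | m + e * n%:R <= X x]); last first.
    by apply/seteqP; split=> x; rewrite /A /= XE.
  rewrite -[X in measurable X]setTI.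
  have := measurable_fun_ler (@measurable_cst _ _ _ _ setT (m + e * n%:R)) mX.
  by move=> /(_ measurableT [set true]); apply.
have : (((e * n%:R) ^+ 2)%:E * P A <= \int[P]_x (Y x)%:E)%E.
  have -> : P A = (\int[P]_x (\1_A x)%:E)%E by rewrite integral_indic // setIT.
  rewrite -ge0_integralZl //; last 2 first.
  - exact/measurable_EFinP.
  - by rewrite lee_fin ltW.
  apply: ge0_le_integral => //.
  - by move=> x _; rewrite -EFinM lee_fin mulr_ge0 ?sqr_ge0 // indicE.
  - by apply/measurable_EFinP; apply: measurable_funM.
  - exact/measurable_EFinP.
  move=> x _; rewrite -EFinM lee_fin indicE; case: (boolP (x \in A)); rewrite ?mulr0 ?sqr_ge0 //.
  rewrite inE mulr1 /A /= -XE -/m /Y => le.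
  have le' : e * n%:R <= X x - m by rewrite lerBrDl.
  have le0 : 0 <= e * n%:R by exact: ltW.
  by rewrite ler_sqr // nnegrE // (le_trans le0).
rewrite -lee_pdivlMl // => /le_trans; apply.
apply: le_trans (lee_wpmul2l _ EY) _; first by rewrite lee_fin invr_ge0 ltW.
rewrite -EFinM lee_fin exprMn [n%:R ^+ 2]expr2 mulrA invfM -mulrA mulVf ?mulr1 //.
by rewrite pnatr_eq0 -lt0n.
Qed.
End Probability.

Lemma integral_null_cylinder d1 d2 (T1 : measurableType d1)
    (T2 : measurableType d2) (R : realType) (m1 : {measure set T1 -> \bar R})
    (m2 : {sigma_finite_measure set T2 -> \bar R}) (A : set T1)
    (f : T1 * T2 -> \bar R) :
  measurable A -> measurable_fun setT f -> m1 A = 0%E ->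
  (\int[m1 \x m2]_(x in A `*` setT) f x)%E = 0%E.
Proof.
move=> mA mf A0; apply: null_set_integral.
- exact: measurableX.
- exact: measurable_funS mf.
by rewrite [LHS]product_measure1E // A0 mul0e.
Qed.

Lemma product_measure_point d1 d2 (T1 : measurableType d1)
    (T2 : measurableType d2) (R : realType) (m1 : {measure set T1 -> \bar R})
    (m2 : {sigma_finite_measure set T2 -> \bar R}) a b :
  measurable [set a] -> measurable [set b] -> m1 [set a] = 0%E ->
  (m1 \x m2)%E [set (a, b)] = 0%E.
Proof.
move=> ma mb a0; have -> : [set (a, b)] = [set a] `*` [set b].
  by apply/seteqP; split=> [[x y] /= [-> ->]|[x y] /= [-> ->]].
by rewrite [LHS]product_measure1E // a0 mul0e.
Qed.

Lemma sigma_finite_product d1 d2 (T1 : measurableType d1)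
    (T2 : measurableType d2) (R : realType)
    (m1 : {sigma_finite_measure set T1 -> \bar R})
    (m2 : {sigma_finite_measure set T2 -> \bar R}) :
  sigma_finite setT (m1 \x m2)%E.
Proof.
have /sigma_finiteP[F [FT ndF mF]] := sigma_finiteT m1.
have /sigma_finiteP[G [GT ndG mG]] := sigma_finiteT m2.
exists (fun n => F n `*` G n) => [|n].
  apply/esym; rewrite -subTset => -[x y] _.
  have [i _ Fx] : (\bigcup_i F i) x by rewrite -FT.
  have [j _ Gy] : (\bigcup_i G i) y by rewrite -GT.
  exists (maxn i j) => //; split => /=.
    by have /subsetPset := ndF _ _ (leq_maxl i j); exact.
  by have /subsetPset := ndG _ _ (leq_maxr i j); exact.
have [mFn Fn] := mF n; have [mGn Gn] := mG n; split; first exact: measurableX.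
by rewrite [ltLHS]product_measure1E // lte_mul_pinfty // ge0_fin_numE.
Qed.

Lemma integral_null_plane d (T : measurableType d) (R : realType)
    (m : {sigma_finite_measure set T -> \bar R}) (a b : T)
    (f : (T * T) * (T * T) -> \bar R) :
  measurable [set a] -> measurable [set b] -> measurable_fun setT f ->
  m [set a] = 0%E ->
  (\int[(m \x m) \x (m \x m)]_(x in [set (a, b)] `*` setT) f x)%E = 0%E.
Proof.
move=> ma mb mf a0.
(* Inference only finds the structure of products of probabilities here. *)
pose mm : {sigma_finite_measure set (T * T)%type -> \bar R} :=
  HB.pack (m \x m)%E
    (Measure_isSigmaFinite.Build _ _ _ (m \x m)%E (sigma_finite_product m m)).
apply: (@integral_null_cylinder _ _ _ _ R mm mm).
- have -> : [set (a, b)] = [set a] `*` [set b].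
    by apply/seteqP; split=> [[x y] /= [-> ->]|[x y] /= [-> ->]].
  exact: measurableX.
- exact: mf.
- exact: (@product_measure_point _ _ _ _ _ m m).
Qed.

(** The events decrease to [v 0 0 = 0], a plane of codimension two in [R^4], which is null for a law
    with a density. *)
Lemma density_small_ball (R : realType) (mu : probability 'rV[R[i]]_2 R) (e : R) :
  has_density mu -> 0 < e ->
  exists2 tau : R, 0 < tau & (mu [set v | (sqmod (v 0%R 0%R) <= tau)%R] <= e%:E)%E.
Proof.
move=> [f [mf f0 Hf]] e0.
pose F k := [set v : 'rV[R[i]]_2 | sqmod (v 0 0) <= k.+1%:R^-1].
have mF k : measurable (F k).
  by apply: measurable_sqmod_le; exact: measurable_mx_entry.
have niF : nonincreasing_seq F.
  move=> a b ab; apply/subsetPset => v /= /le_trans; apply.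
  by rewrite lef_pV2 ?posrE // ler_nat.
have F0 : mu (\bigcap_n F n) = 0%E.
  have -> : \bigcap_n F n = @realcoords R @^-1` ([set (0, 0)] `*` setT).
    apply/seteqP; split=> [v h|v [/= v0 _] n _].
      split=> //=.
      have sq0 : sqmod (v 0 0) <= 0.
        apply/ler_addgt0Pl => eps eps0; rewrite addr0.
        have := h (Num.truncn eps^-1) I; rewrite /F /= => /le_trans; apply.
        by rewrite invf_ple ?posrE // ltW // truncnS_gt.
      move: sq0; rewrite /realpair /sqmod.
      case: (v 0 0) => a b /= ab.
      have [a0 b0] : a = 0 /\ b = 0 by split; nra.
      by rewrite a0 b0.
    rewrite /F /=; move: v0; rewrite /realpair /sqmod.
    by case: (v 0 0) => a b [/= -> ->]; rewrite expr0n /= addr0 invr_ge0.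
  have mA : measurable ([set ((0 : R), (0 : R))] `*` setT :
     set ((measurableTypeR R * measurableTypeR R) * (measurableTypeR R * measurableTypeR R))).
    apply: measurableX => //.
    have -> : [set ((0 : R), (0 : R))] = [set 0] `*` [set 0].
      by apply/seteqP; split=> [[a b] /= [-> ->]|[a b] /= [-> ->]].
    exact: measurableX.
  rewrite (Hf _ mA).
  apply: (@integral_null_plane _ _ R (@lebesgue_measure R) 0 0 (EFin \o f)) => //.
    exact/measurable_EFinP.
  exact: lebesgue_measure_set1.
have [n Hn] := small_probability mF niF F0 e0.
by exists n.+1%:R^-1; rewrite // invr_gt0.
Qed.

Lemma cnormal_tail (R : realType) (e : R) : 0 < e ->
  exists2 M : R, 0 < M &
    (std_cnormal R [set z | (M <= z.1 ^+ 2 + z.2 ^+ 2)%R] <= e%:E)%E.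
Proof.
move=> e0.
pose F k := [set z : measurableTypeR R * measurableTypeR R |
             k.+1%:R <= (z.1 : R) ^+ 2 + (z.2 : R) ^+ 2].
have mF k : measurable (F k) by exact: measurable_sqr_sum_ge.
have niF : nonincreasing_seq F.
  move=> a b ab; apply/subsetPset => v /=; apply: le_trans.
  by rewrite ler_nat.
have F0 : std_cnormal R (\bigcap_n F n) = 0%E.
  have -> : \bigcap_n F n = set0; last exact: measure0.
  apply/seteqP; split=> // z h.
  have := h (Num.truncn ((z.1 : R) ^+ 2 + (z.2 : R) ^+ 2)) I.
  by rewrite /F /= leNgt truncnS_gt.
have [n Hn] := small_probability mF niF F0 e0.
by exists n.+1%:R.
Qed.

(** * The three-phase scheme *)

Lemma card_split m n (P : pred 'I_(m + n)) :
  #|P| = (#|[pred i | P (lshift n i)]| + #|[pred i | P (rshift m i)]|)%N.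
Proof. by rewrite -!sum1_card big_split_ord. Qed.

Section Scheme.
Variables (F : finFieldType) (n1 n2 n3 : nat).
Local Notation state := (bool * bool)%type.
Local Notation at_ s i := (nth (false, false) s i).

(* Positions repeated in the third phase: those missed by their addressee but
   heard by the other receiver, which can therefore cancel them. *)
Definition relayed (s : seq state) (i : 'I_(n1 + n2)) : bool :=
  if (i < n1)%N then at_ s i == (true, false) else at_ s i == (false, true).

Variable Theta : 'M[F]_(n1 + n2, n3).

Definition relay s (y : 'rV[F]_(n1 + n2)) : 'rV[F]_(n1 + n2) :=
  \row_i (if relayed s i then y 0 i else 0).

Definition transmitted s y : 'rV[F]_(n1 + n2 + n3) :=
  row_mx y (relay s y *m Theta).

(** Delayed state information suffices: the first two phases ignore the states, and the third only
    uses the states of the first two. *)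
Lemma transmitted_causal s s' y (t : 'I_(n1 + n2 + n3)) :
  (forall i, (i < t)%N -> at_ s i = at_ s' i) ->
  transmitted s y 0 t = transmitted s' y 0 t.
Proof.
case: (splitP t) => i ti ss'.
  have -> : t = lshift n3 i by apply: val_inj.
  by rewrite !row_mxEl.
have -> : t = rshift (n1 + n2) i by apply: val_inj.
rewrite !row_mxEr; congr ((_ *m _) _ _); apply/rowP => a; rewrite !mxE.
by rewrite /relayed ss' // ti ltn_addr.
Qed.

Lemma transmittedB s y y' : transmitted s y - transmitted s y'
  = transmitted s (y - y').
Proof.
rewrite /transmitted opp_row_mx add_row_mx -mulmxBl; congr (row_mx _ (_ *m _)).
by apply/rowP => i; rewrite !mxE; case: relayed; rewrite ?subrr.
Qed.

(** By linearity, for [w] a difference of two streams this is the Hamming distance of their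
    transmissions as seen by receiver [k]. *)
Definition confusions (k : 'I_2) s (w : 'rV[F]_(n1 + n2)) : nat :=
  #|[pred t : 'I_(n1 + n2 + n3) | ~~ jammed k (at_ s t) & transmitted s w 0 t != 0]|.

Lemma confusionsE k s w : confusions k s w =
  (#|[pred i : 'I_(n1 + n2) | ~~ jammed k (at_ s i) & w 0%R i != 0%R]|
   + #|[pred t : 'I_n3 | ~~ jammed k (at_ s (n1 + n2 + t))
                        & (relay s w *m Theta) 0%R t != 0%R]|)%N.
Proof.
rewrite /confusions card_split; congr addn; apply: eq_card => i.
  by rewrite !inE row_mxEl.
by rewrite !inE row_mxEr.
Qed.

Variables (D : nat)
  (ThetaP : forall y, y != 0 -> (D < hwt y + hwt (y *m Theta))%N).

(** A jammed symbol of the own phase is either relayed, in state [(true, false)], and then pinned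
    down by [Theta], or jammed at both receivers. Only the latter remain for the outer code. *)
Lemma separation1 s (u : 'rV[F]_n1) (v : 'rV[F]_n2) d :
  (confusions 0%R s (row_mx u v) <= d)%N ->
  (#|[pred i : 'I_n1 | at_ s i == (true, false)]|
   + #|[pred t : 'I_n3 | (at_ s (n1 + n2 + t)).1]| + d <= D)%N ->
  (hwt u <= #|[pred i : 'I_n1 | at_ s i == (true, true)]| + d)%N.
Proof.
rewrite confusionsE => le_d le_D.
pose own := [pred i : 'I_(n1 + n2) | i < n1]%N.
have mask_own i : relayed s i -> ~~ own i -> ~~ jammed 0 (at_ s i).
  by rewrite /relayed /own /=; case: ltnP => // _ /eqP ->.
have card_own (P : pred 'I_(n1 + n2)) :
    #|[pred i | own i && P i]| = #|[pred i | P (lshift n2 i)]|.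
  rewrite card_split [X in (_ + X)%N]eq_card0 ?addn0; last first.
    by move=> i; rewrite !inE /= ltnNge leq_addr.
  by apply: eq_card => i; rewrite !inE /= ltn_ord.
have := @masked_uniqueness F _ _ D Theta (row_mx u v) own (relayed s)
  (fun i => jammed 0 (at_ s i)) (fun t => jammed 0 (at_ s (n1 + n2 + t))) d
  ThetaP mask_own le_d.
rewrite (card_own (fun i => relayed s i && jammed 0 (at_ s i))).
rewrite (card_own (fun i => jammed 0 (at_ s i) && ~~ relayed s i)).
rewrite (card_own (fun i => row_mx u v 0 i != 0)).
have -> : #|[pred i : 'I_n1 | row_mx u v 0%R (lshift n2 i) != 0%R]| = hwt u.
  by apply: eq_card => i; rewrite !inE row_mxEl.
have -> : #|[pred i : 'I_n1 | relayed s (lshift n2 i) & jammed 0 (at_ s (lshift n2 i))]|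
   = #|[pred i : 'I_n1 | at_ s i == (true, false)]|.
  by apply: eq_card => i; rewrite !inE /relayed /= ltn_ord; case: (at_ s i) => [[] []].
have -> : #|[pred i : 'I_n1 | jammed 0 (at_ s (lshift n2 i)) & ~~ relayed s (lshift n2 i)]|
   = #|[pred i : 'I_n1 | at_ s i == (true, true)]|.
  by apply: eq_card => i; rewrite !inE /relayed /= ltn_ord; case: (at_ s i) => [[] []].
by apply.
Qed.

Lemma separation2 s (u : 'rV[F]_n1) (v : 'rV[F]_n2) d :
  (confusions 1%R s (row_mx u v) <= d)%N ->
  (#|[pred i : 'I_n2 | at_ s (n1 + i) == (false, true)]|
   + #|[pred t : 'I_n3 | (at_ s (n1 + n2 + t)).2]| + d <= D)%N ->
  (hwt v <= #|[pred i : 'I_n2 | at_ s (n1 + i) == (true, true)]| + d)%N.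
Proof.
rewrite confusionsE => le_d le_D.
pose own := [pred i : 'I_(n1 + n2) | ~~ (i < n1)]%N.
have mask_own i : relayed s i -> ~~ own i -> ~~ jammed 1 (at_ s i).
  by rewrite /relayed /own /=; case: ltnP => // _ /eqP ->.
have card_own (P : pred 'I_(n1 + n2)) :
    #|[pred i | own i && P i]| = #|[pred i | P (rshift n1 i)]|.
  rewrite card_split [X in (X + _)%N]eq_card0 ?add0n; last first.
    by move=> i; rewrite !inE /= ltn_ord.
  by apply: eq_card => i; rewrite !inE /= ltnNge leq_addr.
have := @masked_uniqueness F _ _ D Theta (row_mx u v) own (relayed s)
  (fun i => jammed 1 (at_ s i)) (fun t => jammed 1 (at_ s (n1 + n2 + t))) d
  ThetaP mask_own le_d.
rewrite (card_own (fun i => relayed s i && jammed 1 (at_ s i))).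
rewrite (card_own (fun i => jammed 1 (at_ s i) && ~~ relayed s i)).
rewrite (card_own (fun i => row_mx u v 0 i != 0)).
have nown (i : 'I_n2) : (n1 + i < n1)%N = false by rewrite ltnNge leq_addr.
have -> : #|[pred i : 'I_n2 | row_mx u v 0%R (rshift n1 i) != 0%R]| = hwt v.
  by apply: eq_card => i; rewrite !inE row_mxEr.
have -> : #|[pred i : 'I_n2 | relayed s (rshift n1 i) & jammed 1 (at_ s (rshift n1 i))]|
   = #|[pred i : 'I_n2 | at_ s (n1 + i) == (false, true)]|.
  by apply: eq_card => i; rewrite !inE /relayed /= nown; case: (at_ s (n1 + i)) => [[] []].
have -> : #|[pred i : 'I_n2 | jammed 1 (at_ s (rshift n1 i)) & ~~ relayed s (rshift n1 i)]|
   = #|[pred i : 'I_n2 | at_ s (n1 + i) == (true, true)]|.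
  by apply: eq_card => i; rewrite !inE /relayed /= nown; case: (at_ s (n1 + i)) => [[] []].
by apply.
Qed.

End Scheme.

(** * Square constellations and minimum-distance matching *)

Section Modulation.
Variable R : realType.
Implicit Types (y h x : R[i]) (s : R).

Lemma sqmodM y h : sqmod (y * h) = sqmod y * sqmod h.
Proof. by rewrite /sqmod; case: y h => [a b] [c d] /=; ring. Qed.

Lemma sqmod_ge0 y : 0 <= sqmod y.
Proof. by rewrite addr_ge0 // sqr_ge0. Qed.

Lemma sqmodB_le y h : sqmod (y - h) <= 2 * sqmod y + 2 * sqmod h.
Proof.
rewrite /sqmod; case: y h => [a b] [c d] /=.
by have := sqr_ge0 (a + c); have := sqr_ge0 (b + d); nra.
Qed.

(** In moduli: [y] is closer to [h * x] than half the spacing [s] scaled by the gain. *)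
Definition matches s y h x : bool := sqmod (y - h * x) < sqmod h * (s ^+ 2 / 4).

(** The bound [|a - b|^2 <= 2 |a|^2 + 2 |b|^2] replaces the triangle inequality; strictness in
    [matches] also covers [h = 0], where nothing matches. *)
Lemma matches_inj (I : eqType) (x : I -> R[i]) s y h (f g : I) :
  (forall f g, f != g -> s ^+ 2 <= sqmod (x f - x g)) ->
  matches s y h (x f) -> matches s y h (x g) -> f = g.
Proof.
move=> sep mf mg; apply/eqP; apply: contraT => /sep le_s.
have : sqmod h * s ^+ 2 <= sqmod (y - h * x g - (y - h * x f)).
  have -> : y - h * x g - (y - h * x f) = h * (x f - x g) by ring.
  by rewrite sqmodM ler_wpM2l ?sqmod_ge0.
move=> /le_trans/(_ (sqmodB_le _ _)); move: mf mg; rewrite /matches; lra.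
Qed.

Lemma matches_noise s h x z tau M : tau < sqmod h -> sqmod z < M ->
  M <= tau * (s ^+ 2 / 4) -> matches s (h * x + z) h x.
Proof.
move=> tau_h z_M M_le; rewrite /matches [h * x + z - _]addrC addKr.
apply: lt_le_trans z_M _; apply: le_trans M_le _.
by apply: ler_wpM2r; [rewrite divr_ge0 // sqr_ge0|exact: ltW].
Qed.

Lemma scaled_square_le s (a b c : R) : 0 <= a -> a <= c -> 0 <= b -> b <= c ->
  (s * a) ^+ 2 + (s * b) ^+ 2 <= 2 * s ^+ 2 * (c * c).
Proof.
move=> a0 ac b0 bc; rewrite !exprMn.
have ac2 : a ^+ 2 <= c ^+ 2 by rewrite ler_sqr ?nnegrE // (le_trans a0).
have bc2 : b ^+ 2 <= c ^+ 2 by rewrite ler_sqr ?nnegrE // (le_trans b0).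
have := ler_wpM2l (sqr_ge0 s) ac2; have := ler_wpM2l (sqr_ge0 s) bc2.
by lra.
Qed.

Lemma distinct_nat_sqr (a b : nat) : a != b -> 1 <= (a%:R - b%:R : R) ^+ 2.
Proof. by case: ltngtP => // + _; rewrite -(ler_nat R) -natr1; nra. Qed.

(** The symbol of rank [a * m + b] is placed at [(s * a, s * b)]. Both coordinates are at most
    [s * m], and distinct points differ by at least [s] in one of them. *)
Lemma grid_constellation (F : finType) m s : #|F| = (m * m)%N ->
  exists x : F -> R[i],
    (forall f, sqmod (x f) <= 2 * s ^+ 2 * (#|F|)%:R) /\
    (forall f g, f != g -> s ^+ 2 <= sqmod (x f - x g)).
Proof.
move=> Fm; pose x (f : F) : R[i] :=
  ((s * (enum_rank f %/ m)%:R) +i* (s * (enum_rank f %% m)%:R))%C.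
have lt_q (f : F) : (enum_rank f < m * m)%N by rewrite -Fm.
have m0 (f : F) : (0 < m)%N by move: (lt_q f); case: (m).
exists x; split=> [f|f g fg].
  have h1 : (enum_rank f %/ m)%:R <= m%:R :> R.
    by rewrite ler_nat ltnW // ltn_divLR // m0.
  have h2 : (enum_rank f %% m)%:R <= m%:R :> R.
    by rewrite ler_nat ltnW // ltn_mod m0.
  have FE : #|F|%:R = m%:R * m%:R :> R by rewrite Fm natrM.
  rewrite /sqmod /x /= FE.
  by apply: scaled_square_le; rewrite ?ler0n.
rewrite /sqmod /x /= -!mulrBr !exprMn.
have s0 := sqr_ge0 s.
have [dE|/(distinct_nat_sqr) ge1] := eqVneq (enum_rank f %/ m)%N (enum_rank g %/ m)%N.
  have : (enum_rank f %% m != enum_rank g %% m)%N.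
    apply: contraNN fg => /eqP mE; apply/eqP/enum_rank_inj/val_inj => /=.
    by rewrite (divn_eq (enum_rank f) m) dE mE -divn_eq.
  by move=> /(distinct_nat_sqr) ge1; rewrite dE subrr expr0n mulr0 add0r ler_peMr.
by apply: ler_wpDr; [rewrite mulr_ge0 // sqr_ge0|rewrite ler_peMr].
Qed.
End Modulation.

(** * Encoder and decoders *)

Section Code.
Variables (R : realType) (F : finFieldType) (n1 n2 n3 k1 k2 : nat).
Local Notation state := (bool * bool)%type.
Local Notation n := (n1 + n2 + n3)%N.
Variables (G1 : 'M[F]_(k1, n1)) (G2 : 'M[F]_(k2, n2)) (Theta : 'M[F]_(n1 + n2, n3)).
Variables (x : F -> R[i]) (s : R) (r : nat).

(** A block code stores the number of messages minus one, hence the predecessor. *)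
Lemma card_rV_pred k : (#|{: 'rV[F]_k}|.-1.+1 = #|{: 'rV[F]_k}|)%N.
Proof. by apply/prednK/card_gt0P; exists 0. Qed.

Definition message k (w : 'I_(#|{: 'rV[F]_k}|.-1.+1)) : 'rV[F]_k :=
  enum_val (cast_ord (card_rV_pred k) w).

Lemma message_inj k : injective (@message k).
Proof. by move=> w w' /enum_val_inj /cast_ord_inj. Qed.

Local Notation M1 := 'I_(#|{: 'rV[F]_k1}|.-1.+1).
Local Notation M2 := 'I_(#|{: 'rV[F]_k2}|.-1.+1).

Definition sent (sg : seq state) (w1 : M1) (w2 : M2) : 'rV[F]_n :=
  transmitted Theta sg (row_mx (message w1 *m G1) (message w2 *m G2)).

(** Only the first antenna carries a signal. The whole word is computed from the known prefix [sg],
    later states defaulting to unjammed; by [transmitted_causal] the symbol at time [t] does not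
    depend on this default. *)
Definition code_encoder (t : nat) (w1 : M1) (w2 : M2) (sg : t.-tuple state) :
    'cV[R[i]]_2 :=
  if insub t is Some i
  then \col_a (if a == 0 then x (sent sg w1 w2 0 i) else 0) else 0.

(** [hit (t, f)] records whether the observation at time [t] matches the symbol [f]; it is all that
    decoding uses of outputs and gains. *)
Definition mismatches (k : 'I_2) (hit : {ffun 'I_n * F -> bool}) sg w1 w2 : nat :=
  #|[pred t : 'I_n | ~~ jammed k (nth (false, false) sg t)
                    & ~~ hit (t, sent sg w1 w2 0 t)]|.

Definition decode1 hit sg : M1 :=
  odflt ord0 [pick w1 | [exists w2, (mismatches 0%R hit sg w1 w2 <= r)%N]].

Definition decode2 hit sg : M2 :=
  odflt ord0 [pick w2 | [exists w1, (mismatches 1%R hit sg w1 w2 <= r)%N]].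

(** A triangle inequality: where both candidates match an unjammed observation, their symbols
    coincide. *)
Lemma mismatches_confusions k (hit : {ffun 'I_n * F -> bool}) sg w1 w2 w1' w2' :
  (forall t f g, hit (t, f) -> hit (t, g) -> f = g) ->
  (mismatches k hit sg w1 w2 <= r)%N -> (mismatches k hit sg w1' w2' <= r)%N ->
  (confusions Theta k sg (row_mx ((message w1 - message w1') *m G1)
                                 ((message w2 - message w2') *m G2)) <= r + r)%N.
Proof.
move=> hit_inj le_r le_r'; apply: leq_trans (leq_add le_r le_r').
rewrite /mismatches -cardUI; apply: leq_trans (leq_addr _ _).
apply/fintype.subset_leq_card/fintype.subsetP => t; rewrite !inE.
rewrite !mulmxBl -add_row_mx -opp_row_mx -transmittedB.
move=> /andP[-> /=]; apply: contraNT; rewrite negb_or !negbK => /andP[h h'].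
by rewrite mxE [X in _ + X]mxE subr_eq0; apply/eqP; exact: hit_inj h h'.
Qed.

Section Decoding.
Variables (D1 D2 D3 : nat).
Hypothesis G1P : forall y, y != 0 -> (D1 < hwt (y *m G1))%N.
Hypothesis G2P : forall y, y != 0 -> (D2 < hwt (y *m G2))%N.
Hypothesis ThetaP : forall y, y != 0 -> (D3 < hwt y + hwt (y *m Theta))%N.

(** The erasures facing [Theta] are the relayed symbols missed in the own phase and the jammed
    third-phase slots; those facing [G1] are the doubly jammed symbols. The term [r + r] appears
    because two candidates with [r] mismatches each are compared. *)
Definition typical1 (sg : seq state) : Prop :=
  (#|[pred i : 'I_n1 | nth (false, false) sg i == (true, false)]|
   + #|[pred t : 'I_n3 | (nth (false, false) sg (n1 + n2 + t)).1]|
   + (r + r) <= D3)%N /\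
  (#|[pred i : 'I_n1 | nth (false, false) sg i == (true, true)]| + (r + r) <= D1)%N.

Definition typical2 (sg : seq state) : Prop :=
  (#|[pred i : 'I_n2 | nth (false, false) sg (n1 + i) == (false, true)]|
   + #|[pred t : 'I_n3 | (nth (false, false) sg (n1 + n2 + t)).2]|
   + (r + r) <= D3)%N /\
  (#|[pred i : 'I_n2 | nth (false, false) sg (n1 + i) == (true, true)]| + (r + r) <= D2)%N.

(** The true pair is a candidate, and any other candidate [w1'] would give a nonzero codeword of
    [G1] of weight at most [D1]. *)
Lemma decode1_correct (hit : {ffun 'I_n * F -> bool}) sg w1 w2 :
  (forall t f g, hit (t, f) -> hit (t, g) -> f = g) -> typical1 sg ->
  (mismatches 0%R hit sg w1 w2 <= r)%N -> decode1 hit sg = w1.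
Proof.
move=> hit_inj [typ3 typ1] le_r; rewrite /decode1; case: pickP => [w1'|]; last first.
  by move=> /(_ w1)/negbT/negP[]; apply/fintype.existsP; exists w2.
move=> /fintype.existsP[w2' le_r'] /=; apply: message_inj; apply/esym/eqP.
rewrite -subr_eq0; apply: contraT => /G1P.
have := mismatches_confusions hit_inj le_r le_r'.
by move=> /(separation1 ThetaP)/(_ typ3) le1; rewrite ltnNge (leq_trans le1 typ1).
Qed.

Lemma decode2_correct (hit : {ffun 'I_n * F -> bool}) sg w1 w2 :
  (forall t f g, hit (t, f) -> hit (t, g) -> f = g) -> typical2 sg ->
  (mismatches 1%R hit sg w1 w2 <= r)%N -> decode2 hit sg = w2.
Proof.
move=> hit_inj [typ3 typ2] le_r; rewrite /decode2; case: pickP => [w2'|]; last first.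
  by move=> /(_ w2)/negbT/negP[]; apply/fintype.existsP; exists w1.
move=> /fintype.existsP[w1' le_r'] /=; apply: message_inj; apply/esym/eqP.
rewrite -subr_eq0; apply: contraT => /G2P.
have := mismatches_confusions hit_inj le_r le_r'.
by move=> /(separation2 ThetaP)/(_ typ3) le1; rewrite ltnNge (leq_trans le1 typ2).
Qed.

End Decoding.

Local Notation obs := (n.-tuple R[i] * n.-tuple ('rV[R[i]]_2 * 'rV[R[i]]_2)
                       * n.-tuple state)%type.

Definition own_gain (k : 'I_2) (h : 'rV[R[i]]_2 * 'rV[R[i]]_2) : R[i] :=
  (if k == 0 then h.1 else h.2) 0 0.

Definition hits k (o : obs) : {ffun 'I_n * F -> bool} :=
  [ffun p => matches s (tnth o.1.1 p.1) (own_gain k (tnth o.1.2 p.1)) (x p.2)].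

(** Decoding factors through this finite-valued map, so its fibers decide the measurability of the
    receivers. *)
Lemma measurable_fibers_hits k :
  measurable_fibers (fun o : obs => (hits k o, o.2)).
Proof.
apply: measurable_fibers_pair.
  apply: measurable_fibers_ffun => -[t f] /=.
  apply: measurable_fibers_bool.
  have my : measurable_fun setT (fun o : obs => tnth o.1.1 t).
    apply: (measurableT_comp (measurable_tnth t)).
    exact: (measurableT_comp measurable_fst measurable_fst).
  have mh : measurable_fun setT (fun o : obs => own_gain k (tnth o.1.2 t)).
    have mt : measurable_fun setT (fun o : obs => tnth o.1.2 t).
      apply: (measurableT_comp (measurable_tnth t)).
      exact: (measurableT_comp measurable_snd measurable_fst).
    rewrite /own_gain; case: (k == 0).
      apply: (measurableT_comp (measurable_mx_entry 0 0)).
      exact: (measurableT_comp measurable_fst mt).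
    apply: (measurableT_comp (measurable_mx_entry 0 0)).
    exact: (measurableT_comp measurable_snd mt).
  rewrite -[X in measurable X]setTI.
  have mc : measurable_fun setT (fun o : obs => own_gain k (tnth o.1.2 t) * x f).
    by apply: measurable_complexM => //; exact: measurable_cst.
  have := measurable_fun_ltr (measurable_sqmod (measurable_complexD my (measurable_complexN mc)))
    (measurable_funM (measurable_sqmod mh) (@measurable_cst _ _ _ _ setT (s ^+ 2 / 4))).
  by move=> /(_ measurableT [set true]); apply.
have -> : snd = (fun o : obs => [tuple tnth o.2 t | t < n]) :> (obs -> _).
  by apply/funext => o /=; apply: eq_from_tnth => t; rewrite tnth_mktuple.
apply: measurable_fibers_tuple => t; apply: measurable_fun_fibers_bool2.
apply: (measurableT_comp (measurable_tnth t)).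
exact: measurable_snd.
Qed.

Definition receiver1 (o : obs) := decode1 (hits 0 o) o.2.

Lemma measurable_receiver1 : measurable_fun setT receiver1.
Proof.
have := @measurable_fibers_measurable_fun _ _
  ({ffun 'I_n * F -> bool} * n.-tuple state)%type _ _ _
  (fun p => decode1 p.1 p.2) (measurable_fibers_hits 0).
exact.
Qed.

Definition receiver2 (o : obs) := decode2 (hits 1 o) o.2.

Lemma measurable_receiver2 : measurable_fun setT receiver2.
Proof.
have := @measurable_fibers_measurable_fun _ _
  ({ffun 'I_n * F -> bool} * n.-tuple state)%type _ _ _
  (fun p => decode2 p.1 p.2) (measurable_fibers_hits 1).
exact.
Qed.

HB.instance Definition _ :=
  isMeasurableFun.Build _ _ _ _ receiver1 measurable_receiver1.
HB.instance Definition _ :=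
  isMeasurableFun.Build _ _ _ _ receiver2 measurable_receiver2.

Definition relay_code : block_code R n :=
  @BlockCode R n _ _ code_encoder receiver1 receiver2.

End Code.

(** * Measurability of the transmission and reduction to channel events *)

Section Observation.
Variables (R : realType) (ch : channel R) (n : nat) (c : block_code R n).
Local Notation Z := (('I_(size1 c).+1 * 'I_(size2 c).+1) * ch_space ch)%type.

Lemma measurable_fibers_messages :
  measurable_fibers (fun z : Z => (W1 z, W2 z)).
Proof.
apply: measurable_fibers_pair; apply: measurable_fun_fibers_ord.
  exact: (measurableT_comp measurable_fst measurable_fst).
exact: (measurableT_comp measurable_snd measurable_fst).
Qed.

Lemma measurable_fibers_states t :
  measurable_fibers (fun z : Z => [tuple ch_S ch i z.2 | i < t]).
Proof.
apply: measurable_fibers_tuple => i; apply: measurable_fun_fibers_bool2.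
exact: (measurableT_comp (@measurable_funPT _ _ _ _ (ch_S ch i)) measurable_snd).
Qed.

(** The input is a function of messages and past states, which take finitely many values on
    measurable fibers. *)
Lemma measurable_input_comp t d (Y : measurableType d) (g : 'cV[R[i]]_2 -> Y) :
  measurable_fun setT (fun z : Z => g (@input R ch n c t z)).
Proof.
have mf := measurable_fibers_pair measurable_fibers_messages (@measurable_fibers_states t).
have := @measurable_fibers_measurable_fun _ _
  (('I_(size1 c).+1 * 'I_(size2 c).+1) * t.-tuple (bool * bool))%type _ _ _
  (fun p => g (encoder c t p.1.1 p.1.2 p.2)) mf.
exact.
Qed.

Lemma measurable_output k t :
  measurable_fun setT (fun z : Z => output k t (@input R ch n c t z) z.2).
Proof.
have mH j : measurable_fun setT (fun z : Z => ch_H ch k t z.2 0 j).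
  apply: (measurableT_comp (measurable_mx_entry 0 j)).
  exact: (measurableT_comp (@measurable_funPT _ _ _ _ (ch_H ch k t)) measurable_snd).
have mG j : measurable_fun setT (fun z : Z => ch_G ch k t z.2 0 j).
  apply: (measurableT_comp (measurable_mx_entry 0 j)).
  exact: (measurableT_comp (@measurable_funPT _ _ _ _ (ch_G ch k t)) measurable_snd).
have mJ j : measurable_fun setT (fun z : Z => ch_J ch t z.2 j 0).
  apply: (measurableT_comp (measurable_mx_entry j 0)).
  exact: (measurableT_comp (@measurable_funPT _ _ _ _ (ch_J ch t)) measurable_snd).
have mN : measurable_fun setT (fun z : Z => ch_N ch k t z.2).
  exact: (measurableT_comp (@measurable_funPT _ _ _ _ (ch_N ch k t)) measurable_snd).
have mS : measurable_fun setT (fun z : Z => (jammed k (ch_S ch t z.2))%:R : R[i]).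
  have mS0 : measurable_fibers (fun z : Z => ch_S ch t z.2).
    apply: measurable_fun_fibers_bool2.
    exact: (measurableT_comp (@measurable_funPT _ _ _ _ (ch_S ch t)) measurable_snd).
  exact: (measurable_fibers_measurable_fun (fun b => (jammed k b)%:R : R[i]) mS0).
have mX j := measurable_input_comp t (fun X => X j 0).
rewrite /output; apply: measurable_complexD => //.
apply: measurable_complexD.
  under eq_fun do rewrite mxE big_ord_recl big_ord1.
  by apply: measurable_complexD; apply: measurable_complexM.
apply: measurable_complexM => //.
under eq_fun do rewrite mxE big_ord_recl big_ord1.
by apply: measurable_complexD; apply: measurable_complexM.
Qed.

Lemma measurable_observation k :
  measurable_fun setT (@observation R ch n c k : Z -> _).
Proof.
have mH l (t : nat) : measurable_fun setT (fun z : Z => ch_H ch l t z.2).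
  exact: (measurableT_comp (@measurable_funPT _ _ _ _ (ch_H ch l t)) measurable_snd).
apply: measurable_fun_pair; first apply: measurable_fun_pair.
- apply/measurable_fun_tnthP => t.
  apply: (eq_measurable_fun _ _ (measurable_output k t)) => z _ /=.
  by rewrite tnth_mktuple.
- apply/measurable_fun_tnthP => t.
  apply: (eq_measurable_fun _ _ (measurable_fun_pair (mH 0 t) (mH 1 t))) => z _ /=.
  by rewrite tnth_mktuple.
- apply/measurable_fun_tnthP => t.
  apply: (eq_measurable_fun _ _ (measurableT_comp (@measurable_funPT _ _ _ _ (ch_S ch t)) measurable_snd)) => z _ /=.
  by rewrite tnth_mktuple.
Qed.

Lemma measurable_neq (m : nat) (f g : Z -> 'I_m.+1) :
  measurable_fun setT f -> measurable_fun setT g ->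
  measurable [set z | f z <> g z].
Proof.
move=> /measurable_fun_fibers_ord mf /measurable_fun_fibers_ord mg.
have := measurable_fibers_preimage [set p | p.1 <> p.2] (measurable_fibers_pair mf mg).
exact.
Qed.

Lemma measurable_error1 :
  measurable [set z : Z | decoder1 c (@observation R ch n c 0 z) <> W1 z].
Proof.
apply: measurable_neq.
  exact: measurableT_comp (@measurable_funPT _ _ _ _ (decoder1 c)) (measurable_observation 0).
exact: (measurableT_comp measurable_fst measurable_fst).
Qed.

Lemma measurable_error2 :
  measurable [set z : Z | decoder2 c (@observation R ch n c 1 z) <> W2 z].
Proof.
apply: measurable_neq.
  exact: measurableT_comp (@measurable_funPT _ _ _ _ (decoder2 c)) (measurable_observation 1).
exact: (measurableT_comp measurable_snd measurable_fst).
Qed.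

(** The cylinder over [B] has the probability of [B], since the messages carry total mass one. Thus
    one bad channel event bounds the error for all messages at once. *)
Lemma joint_prob_le (E : set Z) (B : set (ch_space ch)) : measurable E ->
  measurable B -> (forall z, E z -> B z.2) ->
  (joint_prob ch c E <= ch_prob ch B)%E.
Proof.
move=> mE mB EB.
have <- : joint_prob ch c (setT `*` B) = ch_prob ch B.
  rewrite [LHS]product_measure1E // -[RHS]mul1e; congr (_ * _)%E.
  exact: probability_setT.
apply: le_measure; rewrite ?inE //; first exact: measurableX.
by move=> z /EB.
Qed.

Lemma input_power PT : (forall t w1 w2 sg, sqnorm (encoder c t w1 w2 sg) <= PT) ->
  power_constraint ch c PT.
Proof.
move=> le_PT t _; rewrite -[leRHS](expectation_cst (joint_prob ch c)).
apply: expectation_le => //.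
- exact: (measurable_input_comp t (fun X => sqnorm X)).
- by move=> z; rewrite /sqnorm; do 2 apply: sumr_ge0 => ? _; rewrite addr_ge0 ?sqr_ge0.
- move=> z; apply: le_trans (le_PT t (W1 z) (W2 z) [tuple ch_S ch i z.2 | i < t]).
  by rewrite /sqnorm; do 2 apply: sumr_ge0 => ? _; rewrite addr_ge0 ?sqr_ge0.
- by apply/aeW => z; exact: le_PT.
Qed.

End Observation.

(** * Correct decoding outside atypical channel realizations *)

Section RelayCodeDecoding.
Variables (R : realType) (ch : channel R) (F : finFieldType) (n1 n2 n3 k1 k2 : nat).
Local Notation n := (n1 + n2 + n3)%N.
Variables (G1 : 'M[F]_(k1, n1)) (G2 : 'M[F]_(k2, n2)) (Theta : 'M[F]_(n1 + n2, n3)).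
Variables (x : F -> R[i]) (s : R) (r : nat).
Local Notation code := (relay_code G1 G2 Theta x s r).

Lemma code_encoder_power PT t w1 w2 sg : 0 <= PT ->
  (forall f, sqmod (x f) <= PT) -> sqnorm (encoder code t w1 w2 sg) <= PT.
Proof.
move=> PT0 xPT; rewrite /= /code_encoder; case: insubP => [i _ _|_].
  rewrite /sqnorm big_ord_recl big_ord1 !big_ord1 !mxE /=.
  by rewrite expr0n /= !addr0; exact: xPT.
rewrite /sqnorm big1 // => i _; rewrite big1 // => j _.
by rewrite mxE /= expr0n /= addr0.
Qed.

Definition noisy tau M k t (w : ch_space ch) : bool :=
  (sqmod (ch_H ch k t w 0 0) <= tau) || (M <= sqmod (ch_N ch k t w)).

Definition states (w : ch_space ch) : n.-tuple (bool * bool) :=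
  [tuple ch_S ch i w | i < n].

Lemma nth_states m (w : ch_space ch) i : (i < m)%N ->
  nth (false, false) [tuple ch_S ch j w | j < m] i = ch_S ch i w.
Proof. by move=> im; rewrite -(tnth_nth _ _ (Ordinal im)) tnth_mktuple. Qed.

(** Without jamming and with the second antenna silent, the output is a scalar gain times the symbol
    plus noise. *)
Lemma observation_hits tau M k (z : sample ch code) (t : 'I_n) :
  M <= tau * (s ^+ 2 / 4) -> ~~ jammed k (ch_S ch t z.2) ->
  ~~ noisy tau M k t z.2 ->
  hits x s k (observation k z) (t, sent G1 G2 Theta (states z.2) (W1 z) (W2 z) 0 t).
Proof.
move=> Mtau /negbTE nj; rewrite /noisy negb_or -!ltNge => /andP[hH hN].
rewrite ffunE /= !tnth_mktuple /=.
have -> : own_gain k (ch_H ch 0 t z.2, ch_H ch 1 t z.2) = ch_H ch k t z.2 0 0.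
  rewrite /own_gain; case: k {nj hH hN} => [[|[|]]] //= p.
    by congr (ch_H ch _ _ _ _ _); apply: val_inj.
  by congr (ch_H ch _ _ _ _ _); apply: val_inj.
have -> : output k t (input t z) z.2
    = ch_H ch k t z.2 0 0 * x (sent G1 G2 Theta (states z.2) (W1 z) (W2 z) 0 t)
      + ch_N ch k t z.2.
  rewrite /output nj mul0r addr0 mxE big_ord_recl big_ord1 /input /= /code_encoder.
  rewrite insubT // => tn.
  rewrite ![(\col__ _) _ _]mxE /= mulr0 addr0.
  congr (_ * x _ + _); rewrite /sent.
  have -> : Sub (nat_of_ord t) tn = t by apply: val_inj.
  (* The encoder has used the states before [t], whereas [states] contains the whole block. *)
  apply: transmitted_causal => i it.
  by rewrite !nth_states // (ltn_trans it).
exact: matches_noise hN Mtau.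
Qed.

Lemma mismatches_noisy tau M k (z : sample ch code) :
  M <= tau * (s ^+ 2 / 4) ->
  (#|[pred t : 'I_n | noisy tau M k t z.2]| <= r)%N ->
  (mismatches G1 G2 Theta k (hits x s k (observation k z)) (states z.2) (W1 z) (W2 z)
     <= r)%N.
Proof.
move=> Mtau; apply: leq_trans.
apply/fintype.subset_leq_card/fintype.subsetP => t; rewrite !inE => /andP[nj].
rewrite nth_states // in nj.
by apply: contraNT => nn; exact: (observation_hits Mtau nj nn).
Qed.

Hypothesis sep : forall f g, f != g -> s ^+ 2 <= sqmod (x f - x g).

Lemma hits_inj k (o : n.-tuple R[i] * n.-tuple ('rV[R[i]]_2 * 'rV[R[i]]_2)
                      * n.-tuple (bool * bool)) t f g :
  hits x s k o (t, f) -> hits x s k o (t, g) -> f = g.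
Proof. by rewrite !ffunE /=; exact: matches_inj. Qed.

Variables (D1 D2 D3 : nat).
Hypothesis G1P : forall y, y != 0 -> (D1 < hwt (y *m G1))%N.
Hypothesis G2P : forall y, y != 0 -> (D2 < hwt (y *m G2))%N.
Hypothesis ThetaP : forall y, y != 0 -> (D3 < hwt y + hwt (y *m Theta))%N.

Lemma relay_code_decodes1 tau M (z : sample ch code) :
  M <= tau * (s ^+ 2 / 4) -> typical1 n1 n2 n3 r D1 D3 (states z.2) ->
  (#|[pred t : 'I_n | noisy tau M 0%R t z.2]| <= r)%N ->
  decoder1 code (observation 0 z) = W1 z.
Proof.
move=> Mtau typ le_r; apply: (decode1_correct G1P ThetaP _ typ).
  by move=> t f g; exact: hits_inj.
exact: (mismatches_noisy Mtau le_r).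
Qed.

Lemma relay_code_decodes2 tau M (z : sample ch code) :
  M <= tau * (s ^+ 2 / 4) -> typical2 n1 n2 n3 r D2 D3 (states z.2) ->
  (#|[pred t : 'I_n | noisy tau M 1%R t z.2]| <= r)%N ->
  decoder2 code (observation 1 z) = W2 z.
Proof.
move=> Mtau typ le_r; apply: (decode2_correct G2P ThetaP _ typ).
  by move=> t f g; exact: hits_inj.
exact: (mismatches_noisy Mtau le_r).
Qed.

End RelayCodeDecoding.

(** * Error probability *)

Section Independence.
Context d (T : measurableType d) (R : realType) (P : probability T R).

Lemma independent_pair (I : eqType) (E : I -> set (set T)) i j A B :
  mutually_independent P E -> i != j -> E i A -> E j B ->
  P (A `&` B) = (P A * P B)%E.
Proof.
move=> indep ij EA EB.
have := indep [:: i; j] (fun l => if l == i then A else B).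
rewrite /= inE ij /= big_cons big_seq1 eqxx [j == i]eq_sym (negbTE ij).
have -> : \bigcap_(l in [set` [:: i; j]]) (if l == i then A else B) = A `&` B.
  apply/seteqP; split=> [w h|w [wA wB] l _ /=]; last by case: ifP.
  split; first by have := h i; rewrite /= !inE eqxx => /(_ isT).
  by have := h j; rewrite /= !inE eqxx orbT [j == i]eq_sym (negbTE ij) => /(_ isT).
apply => // l; rewrite !inE => /orP[/eqP ->|/eqP ->]; first by rewrite eqxx.
by rewrite eq_sym (negbTE ij).
Qed.

Lemma iid_upper_tail (J : eqType) d' (T' : measurableType d') (X : J -> T -> T')
    (C : T' -> bool) (I : finType) (f : I -> J) (p e : R) (n : nat) :
  mutually_independent P (fun j => g_sigma_algebra_preimage (X j)) ->
  (forall j, measurable_fun setT (X j)) -> measurable [set y | C y] ->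
  injective f -> (forall i, P [set w | C (X (f i) w)] = p%:E) ->
  (#|I| <= n)%N -> (0 < n)%N -> 0 < e ->
  (P [set w | (p * #|I|%:R + e * n%:R <= #|[pred i | C (X (f i) w)]|%:R)%R]
     <= ((e ^+ 2 * n%:R)^-1)%:E)%E.
Proof.
move=> indep mX mC f_inj Pp; apply: count_upper_tail => // [i|i j ij].
  by have := mX (f i) measurableT _ mC; rewrite setTI.
rewrite (independent_pair (i := f i) (j := f j) indep) ?(inj_eq f_inj) //.
- by rewrite !Pp.
- by exists [set y | C y] => //; rewrite setTI.
- by exists [set y | C y] => //; rewrite setTI.
Qed.

End Independence.

Section ChannelEvents.
Variables (R : realType) (lambda : bool -> bool -> R).
Variables (muH muG : 'I_2 -> probability 'rV[R[i]]_2 R) (PT : R) (ch : channel R).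
Hypothesis assum : channel_assumptions lambda muH muG PT ch.
Local Notation P := (ch_prob ch).

Lemma measurable_state_event (C : bool * bool -> bool) t :
  measurable [set w | C (ch_S ch t w)].
Proof.
have mS : measurable_fibers (ch_S ch t).
  by apply: measurable_fun_fibers_bool2; exact: measurable_funPT.
exact: (measurable_fibers_preimage [set c | C c] mS).
Qed.

Lemma state_probU (C : bool * bool -> bool) t a b a' b' :
  (a, b) != (a', b') ->
  (forall c, C c = (c == (a, b)) || (c == (a', b'))) ->
  P [set w | C (ch_S ch t w)] = (lambda a b + lambda a' b')%:E.
Proof.
move=> ne CE.
have -> : [set w | C (ch_S ch t w)]
    = (ch_S ch t @^-1` [set (a, b)]) `|` (ch_S ch t @^-1` [set (a', b')]).
  apply/seteqP; split=> w /=; rewrite CE.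
    by move=> /orP[/eqP|/eqP]; [left|right].
  by case=> ->; rewrite eqxx ?orbT.
have mS : measurable_fibers (ch_S ch t).
  by apply: measurable_fun_fibers_bool2; exact: measurable_funPT.
rewrite measureU //.
  by rewrite EFinD; congr (_ + _)%E; exact: (ch_S_law assum).
apply/seteqP; split=> // w [/= -> abE].
by move: ne; rewrite abE eqxx.
Qed.

Lemma state_prob1 (C : bool * bool -> bool) t a b :
  (forall c, C c = (c == (a, b))) ->
  P [set w | C (ch_S ch t w)] = (lambda a b)%:E.
Proof.
move=> CE; rewrite -(ch_S_law assum t); congr (P _).
by apply/seteqP; split=> w /=; rewrite CE => /eqP.
Qed.

Lemma lambda_ge0 a b : 0 <= lambda a b.
Proof. by rewrite -lee_fin -(ch_S_law assum 0%N) measure_ge0. Qed.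

(** The event that receiver 1 is jammed and its complement each consist of two states. *)
Lemma lambda_sum1 :
  lambda false false + lambda false true + lambda true false + lambda true true = 1.
Proof.
have m1 := measurable_state_event (fun c => c.1) 0.
have := @probability_setC _ _ _ P _ m1.
rewrite (_ : ~` _ = [set w | ~~ (ch_S ch 0%N w).1]); last first.
  by apply/seteqP; split=> w /= /negP.
rewrite (@state_probU (fun c => c.1) _ true false true true) //; last first.
  by move=> [[] []].
rewrite (@state_probU (fun c => ~~ c.1) _ false false false true) //; last first.
  by move=> [[] []].
by rewrite -EFinB => -[]; lra.
Qed.

Lemma state_upper_tail (C : bool * bool -> bool) o m p e n :
  (forall t, P [set w | C (ch_S ch t w)] = p%:E) ->
  (m <= n)%N -> (0 < n)%N -> 0 < e ->
  (P [set w | (p * m%:R + e * n%:R <= #|[pred i : 'I_m | C (ch_S ch (o + i)%N w)]|%:R)%R]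
     <= ((e ^+ 2 * n%:R)^-1)%:E)%E.
Proof.
move=> pE mn n0 e0; have := @iid_upper_tail _ _ _ P nat _ _ (fun t => ch_S ch t) C 'I_m
  (fun i => o + i)%N p e n.
rewrite card_ord; apply => //.
- exact: ch_S_indep assum.
- have mid := measurable_fun_fibers_bool2 (@measurable_id _ (bool * bool)%type setT).
  exact: (measurable_fibers_preimage [set c | C c] mid).
- by move=> i i' /addnI /val_inj.
Qed.

Lemma measurable_fading_event k t tau :
  measurable [set w | sqmod (ch_H ch k t w 0 0) <= tau].
Proof.
apply: measurable_sqmod_le.
exact: (measurableT_comp (measurable_mx_entry 0 0) (@measurable_funPT _ _ _ _ (ch_H ch k t))).
Qed.

Lemma measurable_noise_event k t M :
  measurable [set w | M <= sqmod (ch_N ch k t w)].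
Proof. by apply: measurable_sqmod_ge; exact: measurable_funPT. Qed.

Lemma measurable_count (I : finType) (b : I -> ch_space ch -> bool) (y : R) :
  (forall i, measurable [set w | b i w]) ->
  measurable [set w | y <= #|[pred i | b i w]|%:R].
Proof.
move=> mb.
have mf := measurable_fibers_ffun (fun i => measurable_fibers_bool (mb i)).
have := measurable_fibers_preimage
  [set v : {ffun I -> bool} | y <= #|[pred i | v i]|%:R] mf.
congr (measurable _); apply/seteqP; split=> w /=.
  by rewrite (eq_card (B := [pred i | b i w])) // => i; rewrite !inE ffunE.
by rewrite (eq_card (A := [pred i | b i w]) (B := [pred i | [ffun k => b k w] i])) // => i;
  rewrite !inE ffunE.
Qed.

(** Weak gains and loud noises are counted separately. Each has probability at most [e] and deviates
    by less than [e * n] off its bad event, which gives [2 * e * n] twice. *)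
Lemma noisy_upper_tail k tau M e n : (0 < n)%N -> 0 < e ->
  (muH k [set v | (sqmod (v 0%R 0%R) <= tau)%R] <= e%:E)%E ->
  (std_cnormal R [set z | (M <= z.1 ^+ 2 + z.2 ^+ 2)%R] <= e%:E)%E ->
  exists B, [/\ measurable B, (P B <= (2 / (e ^+ 2 * n%:R))%:E)%E &
    forall w, ~ B w -> #|[pred t : 'I_n | noisy tau M k t w]|%:R < 4 * e * n%:R].
Proof.
move=> n0 e0 small loud.
have fin (d : measure_display) (T : measurableType d) (Q : probability T R) A :
    measurable A -> (Q A <= e%:E)%E -> exists2 p, Q A = p%:E & p <= e.
  move=> mA le; have Qfin : Q A \is a fin_num by exact: fin_num_measure.
  exists (fine (Q A)); first by rewrite fineK.
  by rewrite -lee_fin fineK.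
have msmall : measurable [set v : 'rV[R[i]]_2 | sqmod (v 0 0) <= tau].
  by apply: measurable_sqmod_le; exact: measurable_mx_entry.
have mloud := measurable_sqr_sum_ge M.
have [p pE pe] := fin _ _ _ _ msmall small.
have [p' pE' pe'] := fin _ _ _ _ mloud loud.
have [indH lawH] := ch_H_iid assum.
have [indN lawN] := ch_N_iid assum.
pose B1 := [set w | p * n%:R + e * n%:R
  <= #|[pred t : 'I_n | sqmod (ch_H ch k t w 0 0) <= tau]|%:R].
pose B2 := [set w | p' * n%:R + e * n%:R
  <= #|[pred t : 'I_n | M <= sqmod (ch_N ch k t w)]|%:R].
have mB1 : measurable B1.
  by apply: measurable_count => t; exact: measurable_fading_event.
have mB2 : measurable B2.
  by apply: measurable_count => t; exact: measurable_noise_event.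
have inj : injective (fun t : 'I_n => (k, nat_of_ord t)).
  by move=> t t' [] /val_inj.
have PB1 : (P B1 <= ((e ^+ 2 * n%:R)^-1)%:E)%E.
  have := @iid_upper_tail _ _ _ P ('I_2 * nat)%type _ _ (fun kt => ch_H ch kt.1 kt.2)
    (fun v => sqmod (v 0 0) <= tau) 'I_n _ p e n indH _ msmall inj.
  rewrite card_ord; apply => //.
  by move=> i; rewrite -pE -(lawH (k, nat_of_ord i)).
have PB2 : (P B2 <= ((e ^+ 2 * n%:R)^-1)%:E)%E.
  have := @iid_upper_tail _ _ _ P ('I_2 * nat)%type _ _
    (fun kt => @realpair R \o ch_N ch kt.1 kt.2)
    (fun z => M <= (z.1 : R) ^+ 2 + (z.2 : R) ^+ 2) 'I_n _ p' e n indN _ mloud inj.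
  rewrite card_ord; apply => //.
  - move=> j; apply: measurableT_comp; first exact: measurable_realpair.
    exact: measurable_funPT.
  - by move=> i; rewrite -pE' -(lawN (k, nat_of_ord i)).
exists (B1 `|` B2); split; first exact: measurableU.
  apply: le_trans (measureU2 _ mB1 mB2) _.
  apply: le_trans (leeD PB1 PB2) _.
  rewrite -EFinD lee_fin; move: _^-1 => y; lra.
move=> w /not_orP[/negP + /negP]; rewrite -!ltNge => l1 l2.
have : (#|[pred t : 'I_n | noisy tau M k t w]|
    <= #|[pred t : 'I_n | (sqmod (ch_H ch k t w 0 0) <= tau)%R]|
       + #|[pred t : 'I_n | (M <= sqmod (ch_N ch k t w))%R]|)%N.
  rewrite -cardUI; apply: leq_trans (leq_addr _ _).
  by apply/fintype.subset_leq_card/fintype.subsetP => t; rewrite !inE.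
rewrite -(ler_nat R) natrD => /le_lt_trans; apply.
have nn : 0 < n%:R :> R by rewrite ltr0n.
have h1 : p * n%:R <= e * n%:R by rewrite ler_pM2r.
have h2 : p' * n%:R <= e * n%:R by rewrite ler_pM2r.
by lra.
Qed.

End ChannelEvents.

Lemma le_truncnP (R : realType) (x : R) m : m%:R <= x -> (m <= Num.truncn x)%N.
Proof. by move=> mx; rewrite truncn_ge_nat // (le_trans _ mx). Qed.

(** * A code of given block length and power *)

Section FixedLength.
Variables (R : realType) (lambda : bool -> bool -> R).
Variables (muH muG : 'I_2 -> probability 'rV[R[i]]_2 R) (PT : R) (ch : channel R).
Hypothesis assum : channel_assumptions lambda muH muG PT ch.
Local Notation P := (ch_prob ch).
Variables (e tau M s : R).
Hypothesis e0 : 0 < e.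
Hypothesis small_gain : forall k,
  (muH k [set v | (sqmod (v 0%R 0%R) <= tau)%R] <= e%:E)%E.
Hypothesis loud_noise :
  (std_cnormal R [set z | (M <= z.1 ^+ 2 + z.2 ^+ 2)%R] <= e%:E)%E.

(** The factor [5] adds three state counts and the two events of [noisy_upper_tail]. [o] and [o']
    are the starting times of the own phase and of the third phase. *)
Lemma channel_bad_event k (C1 C2 C3 : bool * bool -> bool) o m o' m' p1 p2 p3 n :
  (forall t, P [set w | C1 (ch_S ch t w)] = p1%:E) ->
  (forall t, P [set w | C2 (ch_S ch t w)] = p2%:E) ->
  (forall t, P [set w | C3 (ch_S ch t w)] = p3%:E) ->
  (m <= n)%N -> (m' <= n)%N -> (0 < n)%N ->
  exists B, [/\ measurable B, (P B <= (5 / (e ^+ 2 * n%:R))%:E)%E &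
    forall w, ~ B w ->
      [/\ #|[pred i : 'I_m | C1 (ch_S ch (o + i)%N w)]|%:R < p1 * m%:R + e * n%:R,
          #|[pred i : 'I_m | C2 (ch_S ch (o + i)%N w)]|%:R < p2 * m%:R + e * n%:R,
          #|[pred i : 'I_m' | C3 (ch_S ch (o' + i)%N w)]|%:R < p3 * m'%:R + e * n%:R
        & #|[pred t : 'I_n | noisy tau M k t w]|%:R < 4 * e * n%:R]].
Proof.
move=> P1 P2 P3 mn mn' n0.
have [B [mB PB HB]] := noisy_upper_tail assum n0 e0 (small_gain k) loud_noise.
have t1 := state_upper_tail assum o P1 mn n0 e0.
have t2 := state_upper_tail assum o P2 mn n0 e0.
have t3 := state_upper_tail assum o' P3 mn' n0 e0.
set B1 := [set w | _] in t1; set B2 := [set w | _] in t2; set B3 := [set w | _] in t3.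
have mcount (C : bool * bool -> bool) a l (y : R) :
    measurable [set w | y <= #|[pred i : 'I_l | C (ch_S ch (a + i)%N w)]|%:R].
  by apply: measurable_count => i; exact: measurable_state_event.
have m1 : measurable B1 by exact: mcount.
have m2 : measurable B2 by exact: mcount.
have m3 : measurable B3 by exact: mcount.
exists (B1 `|` B2 `|` B3 `|` B); split.
- by do 3 (apply: measurableU => //).
- have mB12 : measurable (B1 `|` B2) by exact: measurableU.
  have mB123 : measurable (B1 `|` B2 `|` B3) by exact: measurableU.
  apply: le_trans (measureU2 _ mB123 mB) _.
  apply: le_trans (leeD (measureU2 _ mB12 m3) PB) _.
  apply: le_trans (leeD (leeD (measureU2 _ m1 m2) t3) (le_refl _)) _.
  apply: le_trans (leeD (leeD (leeD t1 t2) (le_refl _)) (le_refl _)) _.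
  by rewrite -!EFinD lee_fin; move: _^-1 => y; lra.
move=> w /not_orP[/not_orP[/not_orP[/negP + /negP +] /negP +] /HB].
by rewrite -!ltNge.
Qed.

Variables (j n1 n2 k1 k2 n : nat).
Hypothesis M_le : M <= tau * (s ^+ 2 / 4).
Hypothesis PT0 : 0 <= PT.
Hypothesis s_PT : 2 * s ^+ 2 * (2 ^ (2 * j))%:R <= PT.
Hypothesis j0 : (0 < j)%N.
Hypothesis ej : 1 < 2 * e * j%:R.
Hypothesis n0 : (0 < n)%N.
Hypothesis n12 : (n1 + n2 <= n)%N.
Local Notation n3 := (n - (n1 + n2))%N.
(** The slack [12 * e * n] is [8 * e * n] for [r + r], [e * n] for each of two state counts, and
    [2 * e * n] for the gap between [D3] and [n3]. *)
Hypothesis room1 : lambda true false * n1%:R + 12 * e * n%:R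
  <= (lambda false false + lambda false true) * n3%:R.
Hypothesis room2 : lambda false true * n2%:R + 12 * e * n%:R
  <= (lambda false false + lambda true false) * n3%:R.
(** The slack is [e * n] for a state count, [8 * e * n] for [r + r], and [e * n] for counting
    low-weight words. When it exceeds the main term, only the empty message is sent. *)
Hypothesis rate1 : k1 = 0%N \/
  k1%:R <= (1 - lambda true true) * n1%:R - 10 * e * n%:R.
Hypothesis rate2 : k2 = 0%N \/
  k2%:R <= (1 - lambda true true) * n2%:R - 10 * e * n%:R.

Lemma distance_code (F : finFieldType) k m : #|F| = (2 ^ (2 * j))%N -> (m <= n)%N ->
  k = 0%N \/ k%:R <= (1 - lambda true true) * m%:R - 10 * e * n%:R ->
  exists G : 'M[F]_(k, m), forall y, y != 0 ->
    (Num.truncn (lambda true true * m%:R + 9 * e * n%:R) < hwt (y *m G))%N.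
Proof.
move=> Fq mn [k0|rate].
  subst k; exists 0 => y /eqP[]; apply/rowP => -[] //.
apply: gilbert_varshamov; rewrite Fq -!expnM -!expnD ltn_exp2l //.
rewrite -(ltr_nat R) !natrD !natrM.
set D := Num.truncn _.
have DE : D%:R <= lambda true true * m%:R + 9 * e * n%:R.
  have lm : 0 <= lambda true true * m%:R by rewrite mulr_ge0 // (lambda_ge0 assum).
  have en : 0 <= e * n%:R by rewrite mulr_ge0 // ltW.
  by rewrite truncn_le; lra.
have nn : 0 < n%:R :> R by rewrite ltr0n.
have mn' : m%:R <= n%:R :> R by rewrite ler_nat.
have jj : 0 < j%:R :> R by rewrite ltr0n.
have kD : j%:R * (k%:R + D%:R) <= j%:R * (m%:R - e * n%:R) :> R.
  by rewrite ler_pM2l //; lra.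
(* With [q = 2 ^ (2 * j)], a margin of [e * n] symbols outweighs the factor [2 ^ m]. *)
have : n%:R < 2 * e * j%:R * n%:R :> R by rewrite ltr_pMl.
by nra.
Qed.

Lemma code_for_length : exists c : block_code R n,
  [/\ power_constraint ch c PT,
      (size1 c).+1 = ((2 ^ (2 * j)) ^ k1)%N, (size2 c).+1 = ((2 ^ (2 * j)) ^ k2)%N,
      (error1 ch c <= (5 / (e ^+ 2 * n%:R))%:E)%E
    & (error2 ch c <= (5 / (e ^+ 2 * n%:R))%:E)%E].
Proof.
have nE : n = (n1 + n2 + n3)%N by rewrite subnKC.
(* The exponent is even so that the alphabet is a field and fills a square grid. *)
have [|F _ Fq] := @pPrimePowerField 2 (2 * j) isT; first by rewrite muln_gt0.
have nn : 0 < n%:R :> R by rewrite ltr0n.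
have en0 : 0 < e * n%:R by rewrite mulr_gt0.
have n1n : (n1 <= n)%N by apply: leq_trans n12; exact: leq_addr.
have n2n : (n2 <= n)%N by apply: leq_trans n12; exact: leq_addl.
have n3n : (n3 <= n)%N by exact: leq_subr.
have [G1 G1P] := distance_code Fq n1n rate1.
have [G2 G2P] := distance_code Fq n2n rate2.
have l00 := lambda_ge0 assum false false.
have l01 := lambda_ge0 assum false true.
have l10 := lambda_ge0 assum true false.
have l11 := lambda_ge0 assum true true.
have lsum := lambda_sum1 assum.
have n1R : 0 <= n1%:R :> R by [].
have n3R : 0 <= n3%:R :> R by [].
(* The distance [2 * e * n] below [n3] pays for the factor [2 ^ n] in the count of low-weight
   words. *)
set D3 := Num.truncn (n3%:R - 2 * e * n%:R).
have D3E : D3%:R <= n3%:R - 2 * e * n%:R.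
  rewrite truncn_le.
  have := congr1 (fun u => u * n3%:R) lsum; rewrite /= mul1r.
  have := mulr_ge0 l10 n1R; have := mulr_ge0 l10 n3R; have := mulr_ge0 l11 n3R.
  by move: room1; lra.
have [Q QP] : exists Q : 'M[F]_(n1 + n2, n3),
    forall y, y != 0 -> (D3 < hwt y + hwt (y *m Q))%N.
  apply: gilbert_varshamov_systematic.
  rewrite -nE Fq -!expnM -!expnD ltn_exp2l // -(ltr_nat R) natrD !natrM.
  have jj : 0 < j%:R :> R by rewrite ltr0n.
  have : j%:R * D3%:R <= j%:R * (n3%:R - 2 * e * n%:R) by rewrite ler_pM2l.
  have : n%:R < 2 * e * j%:R * n%:R :> R by rewrite ltr_pMl.
  by nra.
have [|x [xP sep]] := @grid_constellation R F (2 ^ j) s.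
  by rewrite Fq -expnD addnn mul2n.
set r := Num.truncn (4 * e * n%:R).
have rE : r%:R <= 4 * e * n%:R by rewrite truncn_le -mulrA mulr_ge0 // ltW.
pose c := relay_code G1 G2 Q x s r.
have fstE (b : bool * bool) : b.1 = (b == (true, false)) || (b == (true, true)).
  by case: b => [[] []].
have sndE (b : bool * bool) : b.2 = (b == (false, true)) || (b == (true, true)).
  by case: b => [[] []].
have [B [mB PB HB]] := channel_bad_event 0 0 (n1 + n2)
  (fun t => state_prob1 assum (C := fun c => c == (true, false)) t (fun c => erefl))
  (fun t => state_prob1 assum (C := fun c => c == (true, true)) t (fun c => erefl))
  (fun t => @state_probU _ _ _ _ _ _ assum (fun c => c.1) t true false true true isT fstE)
  n1n n3n n0.
have [B' [mB' PB' HB']] := channel_bad_event 1 n1 (n1 + n2)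
  (fun t => state_prob1 assum (C := fun c => c == (false, true)) t (fun c => erefl))
  (fun t => state_prob1 assum (C := fun c => c == (true, true)) t (fun c => erefl))
  (fun t => @state_probU _ _ _ _ _ _ assum (fun c => c.2) t false true true true isT sndE)
  n2n n3n n0.
have card_cast k w : #|[pred t : 'I_(n1 + n2 + n3) | noisy tau M k t w]|
    = #|[pred t : 'I_n | noisy tau M k t w]| by rewrite -nE.
have lsum3 : n3%:R = (lambda false false + lambda false true + lambda true false
    + lambda true true) * n3%:R by rewrite lsum mul1r.
(* The length of the relay code equals [n] only through [nE], so the goal is rewritten instead of
   the code. *)
suff : exists c : block_code R (n1 + n2 + n3),
  [/\ power_constraint ch c PT,
      (size1 c).+1 = ((2 ^ (2 * j)) ^ k1)%N, (size2 c).+1 = ((2 ^ (2 * j)) ^ k2)%N,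
      (error1 ch c <= (5 / (e ^+ 2 * n%:R))%:E)%E
    & (error2 ch c <= (5 / (e ^+ 2 * n%:R))%:E)%E] by rewrite -nE.
exists c; split.
- apply: input_power => t w1 w2 sg; apply: code_encoder_power => // f.
  by apply: le_trans (xP f) _; rewrite Fq.
- by rewrite /= card_rV_pred card_mx mul1n Fq.
- by rewrite /= card_rV_pred card_mx mul1n Fq.
- apply: le_trans PB; apply: joint_prob_le => //; first exact: measurable_error1.
  move=> z; apply: contra_notP => nB.
  have [c1 c2 c3 c4] := HB _ nB.
  apply: (relay_code_decodes1 sep G1P QP M_le); last first.
    by rewrite card_cast; apply: le_truncnP; rewrite ltW.
  have E1 b : #|[pred i : 'I_n1 | nth (false, false) (states n1 n2 n3 z.2) i == b]|
      = #|[pred i : 'I_n1 | ch_S ch (0 + i)%N z.2 == b]|.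
    apply: eq_card => i; rewrite !inE nth_states //.
    by rewrite -addnA ltn_addr.
  have E3 : #|[pred t : 'I_n3 | (nth (false, false) (states n1 n2 n3 z.2) (n1 + n2 + t)).1]|
      = #|[pred t : 'I_n3 | (ch_S ch (n1 + n2 + t)%N z.2).1]|.
    by apply: eq_card => i; rewrite !inE nth_states // ltn_add2l.
  split; rewrite E1 ?E3; apply: le_truncnP; rewrite !natrD.
    by move: room1 c1 c3; lra.
  by move: c2; lra.
- apply: le_trans PB'; apply: joint_prob_le => //; first exact: measurable_error2.
  move=> z; apply: contra_notP => nB.
  have [c1 c2 c3 c4] := HB' _ nB.
  apply: (relay_code_decodes2 sep G2P QP M_le); last first.
    by rewrite card_cast; apply: le_truncnP; rewrite ltW.
  have E1 b : #|[pred i : 'I_n2 | nth (false, false) (states n1 n2 n3 z.2) (n1 + i) == b]|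
      = #|[pred i : 'I_n2 | ch_S ch (n1 + i)%N z.2 == b]|.
    apply: eq_card => i; rewrite !inE nth_states //.
    by rewrite ltn_addr // ltn_add2l.
  have E3 : #|[pred t : 'I_n3 | (nth (false, false) (states n1 n2 n3 z.2) (n1 + n2 + t)).2]|
      = #|[pred t : 'I_n3 | (ch_S ch (n1 + n2 + t)%N z.2).2]|.
    by apply: eq_card => i; rewrite !inE nth_states // ltn_add2l.
  split; rewrite E1 ?E3; apply: le_truncnP; rewrite !natrD.
    by move: room2 c1 c3; lra.
  by move: c2; lra.
Qed.

End FixedLength.

(** * Rates *)

Lemma cvg_div_nat (R : realType) (a : R) : a / n%:R @[n --> \oo] --> (0 : R).
Proof.
rewrite -(mulr0 a); apply: cvgMr.
apply/cvgrPdist_le => eps eps0; exists (Num.truncn eps^-1).+1 => // n /= le_n.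
have n0 : 0 < n%:R :> R by rewrite ltr0n (leq_trans _ le_n).
rewrite sub0r normrN gtr0_norm ?invr_gt0 // invf_ple ?posrE //.
by apply: le_trans (ltW (truncnS_gt _)) _; rewrite ler_nat.
Qed.

Section TrivialCode.
Variables (R : realType) (n : nat).

(** Provides zero rates at every power, and fills in block lengths too short for the scheme. *)
Definition trivial_code : block_code R n :=
  @BlockCode R n 0 0 (fun _ _ _ _ => 0) (cst ord0) (cst ord0).

Lemma trivial_code_power (ch : channel R) PT : 0 <= PT ->
  power_constraint ch trivial_code PT.
Proof.
move=> PT0; apply: input_power => t w1 w2 sg /=.
rewrite /sqnorm big1 // => i _; rewrite big1 // => l _.
by rewrite mxE /= expr0n /= addr0.
Qed.

Lemma trivial_code_error (ch : channel R) :
  error1 ch trivial_code = 0%E /\ error2 ch trivial_code = 0%E.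
Proof.
by split; rewrite /error1 /error2 (_ : [set _ | _] = set0) ?measure0 //;
  apply/seteqP; split=> // z /=; rewrite [X in _ <> X]ord1.
Qed.

End TrivialCode.

Lemma achievable_ND_zero (R : realType) (ch : channel R) PT : 0 <= PT ->
  achievable_ND PT ch 0 0.
Proof.
move=> PT0; exists (trivial_code R); split=> [n||||].
- exact: trivial_code_power.
- rewrite /= (_ : (fun _ => _) = fun=> 0); first exact: cvg_cst.
  by apply/funext => n; rewrite ln1 mul0r.
- rewrite /= (_ : (fun _ => _) = fun=> 0); first exact: cvg_cst.
  by apply/funext => n; rewrite ln1 mul0r.
- rewrite (_ : (fun _ => _) = fun=> 0%E); first exact: cvg_cst.
  by apply/funext => n; exact: (trivial_code_error n ch).1.
- rewrite (_ : (fun _ => _) = fun=> 0%E); first exact: cvg_cst.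
  by apply/funext => n; exact: (trivial_code_error n ch).2.
Qed.

(** Truncation loses less than one symbol, that is, at most [l / n] in rate. *)
Lemma cvg_rate (R : realType) (kappa l : R) (m : nat -> nat) (N : nat) :
  0 <= kappa -> 0 <= l ->
  (forall n, (N <= n)%N -> ln (m n)%:R = (Num.truncn (kappa * n%:R))%:R * l) ->
  ln (m n)%:R / n%:R @[n --> \oo] --> kappa * l.
Proof.
move=> kappa0 l0 mE.
have lower : kappa * l - l / n%:R @[n --> \oo] --> kappa * l.
  rewrite -[X in _ --> X]subr0; apply: cvgB; first exact: cvg_cst.
  exact: cvg_div_nat.
apply: squeeze_cvgr lower (cvg_cst _).
exists (maxn N 1) => // n /=; rewrite geq_max => /andP[Nn n0].
have nn : 0 < n%:R :> R by rewrite ltr0n.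
have kn : 0 <= kappa * n%:R by rewrite mulr_ge0.
have /andP[le1 lt1] := truncn_itv kn.
rewrite mE // ler_pdivlMr // ler_pdivrMr // mulrBl divfK ?gt_eqF //.
rewrite -natr1 in lt1.
by have := ler_wpM2r l0 le1; have := ler_wpM2r l0 (ltW lt1); lra.
Qed.

Lemma cvg_error (R : realType) (u : nat -> \bar R) (a : R) (N : nat) :
  (forall n, (0 <= u n)%E) ->
  (forall n, (N <= n)%N -> (u n <= (a / n%:R)%:E)%E) ->
  u n @[n --> \oo] --> 0%E.
Proof.
move=> u0 ua.
apply: (@squeeze_cvge _ _ _ _ (cst 0%E) _ (fun n => (a / n%:R)%:E)).
- by exists N => // n /= Nn; rewrite u0 ua.
- exact: cvg_cst.
- by apply: cvg_EFin; [exact: nearW|exact: cvg_div_nat].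
Qed.

(** With [la = l1], [lb = lambda10] and phase fractions [x = d1 / L], [y = d2 / L], the inequality
    on [x] and [y] is the first bound multiplied by [l1]. Shrinking both phases by [1 - C * e] frees
    [C * e * la * n >= 12 * e * n] in the third phase. *)
Lemma third_phase_room (R : realType) (la lb x y C e n m m' : R) :
  0 < la -> 0 <= lb -> 0 <= e -> 0 <= n -> 12 <= C * la -> C * e < 1 ->
  x * (la + lb) + la * y <= la ->
  m <= (1 - C * e) * x * n -> m' <= (1 - C * e) * y * n ->
  lb * m + 12 * e * n <= la * (n - m - m').
Proof.
move=> la0 lb0 e0 n0 Cla Ce key mx my.
have h1 : (la + lb) * m <= (la + lb) * ((1 - C * e) * x * n).
  by rewrite ler_wpM2l // addr_ge0 // ltW.
have h2 : la * m' <= la * ((1 - C * e) * y * n) by rewrite ler_wpM2l // ltW.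
have h3 : (1 - C * e) * n * (x * (la + lb) + la * y) <= (1 - C * e) * n * la.
  by rewrite ler_wpM2l // mulr_ge0 // subr_ge0 ltW.
have h4 : 12 * (e * n) <= C * la * (e * n) by rewrite ler_wpM2r // mulr_ge0.
by move: h1 h2 h3 h4; lra.
Qed.

(** * Rates achieved at a fixed power *)

Section Achievability.
Variables (R : realType) (lambda : bool -> bool -> R).
Variables (muH muG : 'I_2 -> probability 'rV[R[i]]_2 R) (PT : R) (ch : channel R).
Hypothesis assum : channel_assumptions lambda muH muG PT ch.
Variables (e tau M s : R) (j : nat).
Hypothesis e0 : 0 < e.
Hypothesis small_gain : forall k,
  (muH k [set v | (sqmod (v 0%R 0%R) <= tau)%R] <= e%:E)%E.
Hypothesis loud_noise :
  (std_cnormal R [set z | (M <= z.1 ^+ 2 + z.2 ^+ 2)%R] <= e%:E)%E.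
Hypothesis M_le : M <= tau * (s ^+ 2 / 4).
Hypothesis PT0 : 0 <= PT.
Hypothesis s_PT : 2 * s ^+ 2 * (2 ^ (2 * j))%:R <= PT.
Hypothesis j0 : (0 < j)%N.
Hypothesis ej : 1 < 2 * e * j%:R.
Local Notation l1 := (lambda false false + lambda false true).
Local Notation l2 := (lambda false false + lambda true false).
Local Notation L := (lambda false false + lambda false true + lambda true false).
Variables (d1 d2 C : R).
Hypothesis l1_gt0 : 0 < l1.
Hypothesis l2_gt0 : 0 < l2.
Hypothesis d1_ge0 : 0 <= d1.
Hypothesis d2_ge0 : 0 <= d2.
Hypothesis bound1 : d1 / l1 + d2 / L <= 1.
Hypothesis bound2 : d1 / L + d2 / l2 <= 1.
Hypothesis C1 : 12 <= C * l1.
Hypothesis C2 : 12 <= C * l2.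
Hypothesis Ce : C * e < 1.

(** What remains of [d] after all losses: the shrunk phases, [10 * e] from the outer code, and [e]
    for rounding the phase length. *)
Definition dof_loss (d : R) : R := Num.max 0 ((1 - C * e) * d - 11 * e).

Lemma achievable_fixed : achievable_ND PT ch
  (dof_loss d1 * ln (2 ^ (2 * j))%:R) (dof_loss d2 * ln (2 ^ (2 * j))%:R).
Proof.
have l00 := lambda_ge0 assum false false.
have l01 := lambda_ge0 assum false true.
have l10 := lambda_ge0 assum true false.
have l11 := lambda_ge0 assum true true.
have lsum := lambda_sum1 assum.
have L0 : 0 < L by move: l1_gt0; lra.
have C0 : 0 < C by rewrite -(pmulr_lgt0 _ l1_gt0); move: C1; lra.
have Ce0 : 0 <= C * e by rewrite mulr_ge0 // ltW.
(* From [N] on, [e * n >= 1], which absorbs the rounding of the phase lengths. *)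
pose N := (Num.truncn e^-1).+1.
have code n : exists c : block_code R n, power_constraint ch c PT /\
    ((N <= n)%N -> [/\ (size1 c).+1 = ((2 ^ (2 * j)) ^ Num.truncn (dof_loss d1 * n%:R))%N,
      (size2 c).+1 = ((2 ^ (2 * j)) ^ Num.truncn (dof_loss d2 * n%:R))%N,
      (error1 ch c <= (5 / e ^+ 2 / n%:R)%:E)%E
    & (error2 ch c <= (5 / e ^+ 2 / n%:R)%:E)%E]).
  have [nN|Nn] := ltnP n N.
    by exists (trivial_code R n); split => //; exact: trivial_code_power.
  have n0 : (0 < n)%N by exact: leq_trans Nn.
  have nn : 0 < n%:R :> R by rewrite ltr0n.
  have en1 : 1 <= e * n%:R.
    rewrite -ler_pdivrMl // mulr1.
    by apply: le_trans (ltW (truncnS_gt _)) _; rewrite ler_nat.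
  (* The division by [L] makes up for the fraction [1 - L] of symbols that are jammed at both
     receivers. *)
  pose a1 := (1 - C * e) * (d1 / L). pose a2 := (1 - C * e) * (d2 / L).
  have a10 : 0 <= a1 by rewrite mulr_ge0 ?divr_ge0 // ?(ltW L0) // subr_ge0 ltW.
  have a20 : 0 <= a2 by rewrite mulr_ge0 ?divr_ge0 // ?(ltW L0) // subr_ge0 ltW.
  pose n1 := Num.truncn (a1 * n%:R). pose n2 := Num.truncn (a2 * n%:R).
  have /andP[n1l n1u] : n1%:R <= a1 * n%:R < n1.+1%:R.
    by apply: truncn_itv; rewrite mulr_ge0.
  have /andP[n2l n2u] : n2%:R <= a2 * n%:R < n2.+1%:R.
    by apply: truncn_itv; rewrite mulr_ge0.
  have d1E : d1 = d1 / L * L by rewrite divfK // gt_eqF.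
  have d2E : d2 = d2 / L * L by rewrite divfK // gt_eqF.
  have key1 : d1 + l1 * (d2 / L) <= l1.
    have := ler_wpM2l (ltW l1_gt0) bound1.
    by rewrite mulr1 mulrDr mulrCA divff ?gt_eqF // mulr1.
  have key2 : d2 + l2 * (d1 / L) <= l2.
    have := ler_wpM2l (ltW l2_gt0) bound2.
    by rewrite mulr1 mulrDr [_ * (d2 / _)]mulrCA divff ?gt_eqF // mulr1 addrC.
  have Ce1 : 0 <= 1 - C * e by rewrite subr_ge0 ltW.
  have n12 : (n1 + n2 <= n)%N.
    rewrite -(ler_nat R) natrD; apply: le_trans (lerD n1l n2l) _.
    have xy : d1 / L + d2 / L <= 1.
      have : 0 <= lambda true false * (d1 / L) by rewrite mulr_ge0 // divr_ge0 // ltW.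
      move: key1 d1E; move: (d1 / L) (d2 / L) => x y *.
      by rewrite -(ler_pM2l l1_gt0); lra.
    have := ler_wpM2l (mulr_ge0 Ce1 (ltW nn)) xy.
    have := mulr_ge0 Ce0 (ltW nn).
    by rewrite /a1 /a2; move: (d1 / L) (d2 / L) => x y; lra.
  have n3E : (n - (n1 + n2))%:R = n%:R - n1%:R - n2%:R :> R.
    by rewrite natrB // natrD; ring.
  have room1 : lambda true false * n1%:R + 12 * e * n%:R <= l1 * (n - (n1 + n2))%:R.
    rewrite n3E; apply: (third_phase_room l1_gt0 l10 (ltW e0) (ltW nn) C1 Ce _ n1l n2l).
    by move: key1 d1E; move: (d1 / L) (d2 / L) => x y; lra.
  have room2 : lambda false true * n2%:R + 12 * e * n%:R <= l2 * (n - (n1 + n2))%:R.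
    rewrite n3E addrAC; apply: (third_phase_room l2_gt0 l01 (ltW e0) (ltW nn) C2 Ce _ n2l n1l).
    by move: key2 d2E; move: (d1 / L) (d2 / L) => x y; lra.
  have rate d m : 0 <= d -> (1 - C * e) * (d / L) * n%:R < m.+1%:R ->
      Num.truncn (dof_loss d * n%:R) = 0%N \/
      (Num.truncn (dof_loss d * n%:R))%:R
        <= (1 - lambda true true) * m%:R - 10 * e * n%:R.
    move=> d0 mu; rewrite /dof_loss maxEle; case: ifP => [le0|_]; last first.
      by left; rewrite mul0r truncn0.
    right; apply: le_trans (_ : ((1 - C * e) * d - 11 * e) * n%:R <= _).
      by rewrite truncn_le mulr_ge0.
    have : (1 - C * e) * d * n%:R <= L * m.+1%:R.
      have -> : (1 - C * e) * d * n%:R = L * ((1 - C * e) * (d / L) * n%:R).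
        by field; rewrite gt_eqF.
      by rewrite ler_wpM2l // ltW.
    rewrite -natr1 mulrDr mulr1.
    have -> : 1 - lambda true true = L by move: lsum; lra.
    by move: en1 lsum l11; lra.
  have [c [cP c1 c2 ce1 ce2]] := code_for_length assum e0 small_gain loud_noise
    M_le PT0 s_PT j0 ej n0 n12 room1 room2 (rate _ _ d1_ge0 n1u) (rate _ _ d2_ge0 n2u).
  exists c; split => // _; split => //.
    by apply: le_trans ce1 _; rewrite lee_fin invfM mulrA.
  by apply: le_trans ce2 _; rewrite lee_fin invfM mulrA.
pose c n := projT1 (cid (code n)).
have cP n := projT2 (cid (code n)).
have q1 : 0 <= ln (2 ^ (2 * j))%:R :> R by rewrite ln_ge0 // ler1n expn_gt0.
exists c; split.
- by move=> n; have [] := cP n.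
- apply: (@cvg_rate _ _ _ _ N) => // [|n Nn]; first by rewrite /dof_loss le_max lexx.
  have [_ /(_ Nn)[-> _ _ _]] := cP n.
  by rewrite natrX lnXn ?mulr_natl // ltr0n expn_gt0.
- apply: (@cvg_rate _ _ _ _ N) => // [|n Nn]; first by rewrite /dof_loss le_max lexx.
  have [_ /(_ Nn)[_ -> _ _]] := cP n.
  by rewrite natrX lnXn ?mulr_natl // ltr0n expn_gt0.
- apply: (@cvg_error _ _ (5 / e ^+ 2) N) => n; first exact: measure_ge0.
  by move=> Nn; have [_ /(_ Nn)[]] := cP n.
- apply: (@cvg_error _ _ (5 / e ^+ 2) N) => n; first exact: measure_ge0.
  by move=> Nn; have [_ /(_ Nn)[]] := cP n.
Qed.

End Achievability.

(* A single rate function is obtained by targeting, at power [PT], the best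
   precision [1 / k.+1] with [k <= PT] that is attainable there. *)
Lemma diagonal_rates (R : realType) (Ach : R -> R -> R -> Prop) (d1 d2 : R) :
  (forall PT, 0 < PT -> Ach PT 0 0) ->
  (forall e, 0 < e -> exists PT0, forall PT, PT0 <= PT -> exists r1 r2,
     [/\ Ach PT r1 r2, `|d1 - r1 / ln PT| <= e & `|d2 - r2 / ln PT| <= e]) ->
  exists R1 R2 : R -> R,
    [/\ forall PT, 0 < PT -> Ach PT (R1 PT) (R2 PT),
        R1 PT / ln PT @[PT --> +oo] --> d1
      & R2 PT / ln PT @[PT --> +oo] --> d2].
Proof.
move=> Ach0 Ache.
pose close PT (k : nat) (r : R * R) := [/\ Ach PT r.1 r.2,
  `|d1 - r.1 / ln PT| <= k.+1%:R^-1 & `|d2 - r.2 / ln PT| <= k.+1%:R^-1].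
(* Induction on [m] keeps the pair of the last attainable precision; it also serves all coarser
   ones, since [1 / k.+1] decreases. *)
have best PT m : 0 < PT -> exists r : R * R, Ach PT r.1 r.2 /\
    forall k, (k < m)%N -> (exists r', close PT k r') -> close PT k r.
  move=> PT0; elim: m => [|m [r [Ar Hr]]]; first by exists (0, 0); split => //; exact: Ach0.
  have [[r' [Ar' c1 c2]]|no] := pselect (exists r', close PT m r').
    exists r'; split => // k; rewrite ltnS => km _; split => //.
      by apply: le_trans c1 _; rewrite lef_pV2 ?posrE // ler_nat.
    by apply: le_trans c2 _; rewrite lef_pV2 ?posrE // ler_nat.
  exists r; split => // k; rewrite ltnS leq_eqVlt => /orP[/eqP ->|km]; last exact: Hr.
  by move=> /no.
have /choice[r rP] PT : exists r : R * R, 0 < PT -> Ach PT r.1 r.2 /\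
    forall k, (k < Num.truncn PT)%N -> (exists r', close PT k r') -> close PT k r.
  by have [/(best _ (Num.truncn PT))[r Hr]|_] := ltP 0 PT; [exists r|exists (0, 0)].
have conv eps : 0 < eps -> \forall PT \near +oo,
    `|d1 - (r PT).1 / ln PT| <= eps /\ `|d2 - (r PT).2 / ln PT| <= eps.
  move=> eps0; pose k := Num.truncn eps^-1.
  have k0 : 0 < k.+1%:R^-1 :> R by rewrite invr_gt0.
  have ke : k.+1%:R^-1 <= eps by rewrite invf_ple ?posrE // ltW // truncnS_gt.
  have [PT0 HPT] := Ache _ k0.
  near=> PT.
  have PTge : PT0 <= PT by near: PT; apply: nbhs_pinfty_ge; exact: num_real.
  have PTk : k.+1%:R <= PT by near: PT; apply: nbhs_pinfty_ge; exact: num_real.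
  have PT_gt0 : 0 < PT by rewrite (lt_le_trans _ PTk).
  have [r1 [r2 [A1 a1 a2]]] := HPT _ PTge.
  have [_ /(_ k)] := rP _ PT_gt0.
  case; first by rewrite truncn_ge_nat // ltW.
    by exists (r1, r2).
  by move=> _ b1 b2; split; apply: le_trans ke.
exists (fun PT => (r PT).1), (fun PT => (r PT).2); split.
- by move=> PT /rP[].
- apply/cvgrPdist_le => eps /conv; apply: filterS => PT [].
  by [].
- apply/cvgrPdist_le => eps /conv; apply: filterS => PT [].
  by [].
Unshelve. all: by end_near.
Qed.

(** [rho] stands for [ln q / ln PT]. The error is [(C * d + 11) * e] from [dof_loss] plus [d * e]
    from [rho]. *)
Lemma loss_bound (R : realType) (C e d rho : R) :
  0 <= C -> 0 < e -> 0 <= d -> C * e < 1 -> 1 - e <= rho -> rho <= 1 ->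
  `|d - dof_loss e C d * rho| <= (C * d + d + 11) * e.
Proof.
move=> C0 e0 d0 Ce1 rho1 rho2.
have Ced : 0 <= C * e * d by rewrite !mulr_ge0 // ltW.
have ed : 0 <= e * d by rewrite mulr_ge0 // ltW.
have [k0 kd kge] : [/\ 0 <= dof_loss e C d, dof_loss e C d <= d
    & d - (C * d + 11) * e <= dof_loss e C d].
  rewrite /dof_loss; split; first by rewrite le_max lexx.
    by rewrite ge_max d0 /=; lra.
  by rewrite le_max; apply/orP; right; lra.
have h1 := ler_wpM2l k0 rho1. have h2 := ler_wpM2l k0 rho2.
have h3 : dof_loss e C d * e <= d * e by rewrite ler_wpM2r // ltW.
by rewrite ler_norml; apply/andP; split; move: h1 h2 h3; lra.
Qed.

(* The spacing [s] of the constellation is fixed while the number [4 ^ j] of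
   its points grows like [PT]. *)
Lemma constellation_growth (R : realType) (s e : R) : 1 <= s -> 0 < e -> e <= 2^-1 ->
  exists PT0, forall PT, PT0 <= PT -> exists j,
    let q := (2 ^ (2 * j))%:R : R in
    [/\ 0 < PT, 2 * s ^+ 2 * q <= PT, (0 < j)%N, 1 < 2 * e * j%:R
      & 1 - e <= ln q / ln PT /\ ln q / ln PT <= 1].
Proof.
move=> s1 e0 e2; pose A := 2 * s ^+ 2.
have A1 : 1 <= A by rewrite /A; nra.
have A0 : 0 < A by exact: lt_le_trans A1.
have lnA : 0 <= ln (4 * A) by rewrite ln_ge0; lra.
(* Since [PT <= 4 * A * q], the term [ln (4 * A)] makes the constant factor cost at most a fraction
   [e] of [ln PT]; the added [4] makes [2 * e * j] exceed [1]. *)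
pose y := (ln (4 * A) + 4) / e.
exists (expR y) => PT PTy.
have y4 : ln (4 * A) + 4 <= y.
  by rewrite /y ler_pdivlMr // ler_piMr ?addr_ge0 //; lra.
have PT0 : 0 < PT by apply: lt_le_trans PTy; exact: expR_gt0.
have lnPT : y <= ln PT by rewrite -ler_expR lnK // posrE.
have lnPT0 : 0 < ln PT by apply: lt_le_trans lnPT; lra.
have PTA : A <= PT.
  rewrite -ler_ln ?posrE //; apply: le_trans lnPT; apply: le_trans y4.
  rewrite lnM ?posrE //; have : 0 <= ln (4 : R) by rewrite ln_ge0; lra.
  by lra.
pose m := Num.truncn (PT / A).
have m0 : (0 < m)%N by rewrite truncn_gt0 ler_pdivlMr // mul1r.
(* The largest [j] with [A * 4 ^ j <= PT], so that at most a factor [4] of the power is wasted. *)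
pose j := trunc_log 4 m.
have [jm mj] : (4 ^ j <= m)%N /\ (m < 4 ^ j.+1)%N.
  by have /andP[] := trunc_log_bounds (isT : 1 < 4)%N m0.
have qE : (2 ^ (2 * j) = 4 ^ j)%N by rewrite expnM.
exists j => /=; rewrite qE.
set q : R := (4 ^ j)%:R.
have q1 : 1 <= q by rewrite ler1n expn_gt0.
have q0 : 0 < q by exact: lt_le_trans q1.
have qPT : A * q <= PT.
  rewrite -ler_pdivlMl // mulrC; apply: le_trans (_ : m%:R <= _).
    by rewrite ler_nat.
  by rewrite truncn_le divr_ge0 // ltW.
have PTq : PT <= 4 * A * q.
  have : PT / A < (4 ^ j.+1)%:R.
    by apply: lt_le_trans (truncnS_gt _) _; rewrite ler_nat.
  by rewrite ltr_pdivrMr // expnS natrM => /ltW /le_trans; apply; rewrite -/q; lra.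
have lnq : ln q <= ln PT by rewrite ler_ln ?posrE //; apply: le_trans qPT; rewrite ler_peMl // ltW.
have lnq' : ln PT <= ln (4 * A) + ln q.
  have A4 : 0 < 4 * A by rewrite mulr_gt0.
  by rewrite -lnM ?posrE // ler_ln ?posrE // mulr_gt0.
have eln : ln (4 * A) + 4 <= e * ln PT.
  rewrite -ler_pdivrMl // mulrC; exact: lnPT.
have lnq2 : ln q <= 2 * j%:R.
  rewrite /q -qE natrX lnXn //.
  have -> : ln (2 : R) *+ (2 * j) = 2 * j%:R * ln 2 by rewrite -[LHS]mulr_natl natrM.
  have ln2 : ln (1 + 1 : R) <= 1 by apply: le_ln1Dx; lra.
  by rewrite ler_piMr.
have j2 : 1 < 2 * e * j%:R by nra.
split => //.
- have : 0 < j%:R :> R by nra.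
  by rewrite ltr0n.
split; first by rewrite ler_pdivlMr //; lra.
by rewrite ler_pdivrMr // mul1r.
Qed.

Theorem theorem7 (R : realType) (lambda : bool -> bool -> R)
    (muH muG : 'I_2 -> probability 'rV[R[i]]_2 R) (ch : R -> channel R)
    (muH_density : forall k, has_density (muH k))
    (muH_cov : forall k, identity_covariance (muH k))
    (muG_density : forall k, has_density (muG k))
    (muG_cov : forall k, identity_covariance (muG k))
    (ch_assum : forall PT : R, 0 < PT ->
      channel_assumptions lambda muH muG PT (ch PT))
    (lambda1_gt0 : 0 < lambda false false + lambda false true)
    (lambda2_gt0 : 0 < lambda false false + lambda true false)
    (d1 d2 : R) (d1_ge0 : 0 <= d1) (d2_ge0 : 0 <= d2)
    (bound1 : d1 / (lambda false false + lambda false true)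
      + d2 / (lambda false false + lambda false true + lambda true false) <= 1)
    (bound2 : d1 / (lambda false false + lambda false true + lambda true false)
      + d2 / (lambda false false + lambda true false) <= 1) :
  dof_region_ND ch (d1, d2).
Proof.
apply: (@diagonal_rates R (fun PT => achievable_ND PT (ch PT)) d1 d2).
  by move=> PT PT0; apply: achievable_ND_zero; exact: ltW.
move=> eps eps0.
set l1 := lambda false false + lambda false true in lambda1_gt0 bound1 *.
set l2 := lambda false false + lambda true false in lambda2_gt0 bound2 *.
pose C : R := 12 / l1 + 12 / l2.
have C1 : 12 <= C * l1.
  by rewrite /C mulrDl divfK ?gt_eqF // lerDl mulr_ge0 ?divr_ge0 // ltW.
have C2 : 12 <= C * l2.
  by rewrite /C mulrDl divfK ?gt_eqF // lerDr mulr_ge0 ?divr_ge0 // ltW.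
have C0 : 0 <= C by rewrite addr_ge0 // divr_ge0 // ltW.
(* [K] dominates [1], [C] and the coefficients of [loss_bound] for [d1] and [d2], so one choice of
   [e] meets every smallness condition. *)
pose K := C + C * d1 + C * d2 + d1 + d2 + 11.
have Cd1 : 0 <= C * d1 by rewrite mulr_ge0.
have Cd2 : 0 <= C * d2 by rewrite mulr_ge0.
have K0 : 0 < K by rewrite /K; lra.
pose e := Num.min eps 2^-1 / K.
have e0 : 0 < e by rewrite divr_gt0 // lt_min eps0 /= invr_gt0.
have Ke : K * e = Num.min eps 2^-1 by rewrite mulrC divfK // gt_eqF.
have Ke1 : K * e <= eps by rewrite Ke ge_min lexx.
have Ke2 : K * e <= 2^-1 by rewrite Ke ge_min lexx orbT.
have leK a : a <= K -> a * e <= K * e by move=> aK; rewrite ler_wpM2r // ltW.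
have Ce1 : C * e < 1.
  by apply: le_lt_trans (leK C _) _; [rewrite /K; lra|lra].
have e2 : e <= 2^-1.
  by rewrite -[e]mul1r; apply: le_trans (leK 1 _) Ke2; rewrite /K; lra.
have [tau0 t0 small0] := density_small_ball (muH_density 0) e0.
have [tau1 t1 small1] := density_small_ball (muH_density 1) e0.
have [M M0 loud] := cnormal_tail e0.
pose tau := Num.min tau0 tau1.
have tau_gt0 : 0 < tau by rewrite lt_min t0 t1.
have msmall (y : R) : measurable [set v : 'rV[R[i]]_2 | sqmod (v 0 0) <= y].
  by apply: measurable_sqmod_le; exact: measurable_mx_entry.
have small k : (muH k [set v | (sqmod (v 0%R 0%R) <= tau)%R] <= e%:E)%E.
  have mono y : tau <= y -> (muH k [set v | (sqmod (v 0%R 0%R) <= tau)%R]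
      <= muH k [set v | (sqmod (v 0%R 0%R) <= y)%R])%E.
    move=> tauy; apply: le_measure; rewrite ?inE; [exact: msmall|exact: msmall|].
    by move=> v /= /le_trans; apply.
  have [k0|k1] : k = 0 \/ k = 1.
    by case: k {mono} => [[|[|]]] // p; [left|right]; exact: val_inj.
  - by apply: le_trans (mono tau0 _) _; rewrite ?k0 // ge_min lexx.
  - by apply: le_trans (mono tau1 _) _; rewrite ?k1 // ge_min lexx orbT.
(* Then [s ^+ 2 / 4 = (M / tau + 1) ^+ 2 >= M / tau]; the summand [1] also ensures [1 <= s]. *)
pose s := 2 * (M / tau + 1).
have Mt0 : 0 < M / tau by rewrite divr_gt0.
have s1 : 1 <= s by rewrite /s; lra.
have M_le : M <= tau * (s ^+ 2 / 4).
  have -> : s ^+ 2 / 4 = (M / tau + 1) ^+ 2 by rewrite /s; field; rewrite gt_eqF.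
  rewrite -ler_pdivrMl // mulrC; nra.
have [PT0 HPT] := constellation_growth s1 e0 e2.
exists PT0 => PT /HPT[j /= [PT_gt0 s_PT j0 ej [rho1 rho2]]].
exists (dof_loss e C d1 * ln (2 ^ (2 * j))%:R), (dof_loss e C d2 * ln (2 ^ (2 * j))%:R).
split.
- exact: (achievable_fixed (ch_assum _ PT_gt0) e0 small loud M_le (ltW PT_gt0) s_PT
    j0 ej lambda1_gt0 lambda2_gt0 d1_ge0 d2_ge0 bound1 bound2 C1 C2 Ce1).
- rewrite -mulrA; apply: le_trans (loss_bound C0 e0 d1_ge0 Ce1 rho1 rho2) _.
  by apply: le_trans (leK _ _) Ke1; rewrite /K; lra.
- rewrite -mulrA; apply: le_trans (loss_bound C0 e0 d2_ge0 Ce1 rho1 rho2) _.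
  by apply: le_trans (leK _ _) Ke1; rewrite /K; lra.
Qed.
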